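(* Let $A$ and $B$ be two non-zero metabelian Lie algebras over a field $k$, and let $A\ast B$ be their metabelian product. Then $A\ast B$ is a semidomain if and only if each of $A$ and $B$ is either abelian or a strict semidomain.
   Context: A Lie algebra over $k$ is metabelian if $(a\circ b)\circ(c\circ d)=0$ for all $a,b,c,d$, where $\circ$ is the Lie product. The commutant $L^2$ of a Lie algebra $L$ is the ideal generated by all products $a\circ b$, $a,b\in L$. $\mathcal{A}^2$ is the variety of all metabelian Lie $k$-algebras. If $A=\langle z_i, i\in I_A\mid R_A\rangle$ and $B=\langle z_i, i\in I_B\mid R_B\rangle$ are presentations in $\mathcal{A}^2$ with $I_A\cap I_B=\emptyset$, the metabelian product $A\ast B$ is the algebra with presentation $\langle z_i, i\in I_A\cup I_B\mid R_A\cup R_B\rangle$ in $\mathcal{A}^2$ (i.e. the coproduct of $A$ and $B$ in $\mathcal{A}^2$). For a Lie algebra $L$ over $k$ and $x\in L$, $\langle x\rangle$ denotes the ideal generated by $x$. A nonzero $x\in L$ is a zero divisor if there is a nonzero $y\in L$ with $\langle x\rangle\circ\langle y\rangle=0$. $D(L)$ is the set of all zero divisors of $L$ together with $0$. The Fitting radical $\mathrm{Fit}(L)$ is the ideal generated by the set of all elements of nilpotent ideals of $L$ (equivalently, the set of $x$ such that $\langle x\rangle$ is nilpotent). $L$ is a semidomain if $D(L)=\mathrm{Fit}(L)$, and a strict semidomain if $D(L)=L^2$. *)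

(* Defs.v *)
From HB Require Import structures.
From mathcomp Require Import all_boot all_order all_algebra.
From mathcomp Require Import generic_quotient.
From mathcomp Require Import boolp classical_sets.
Set Implicit Arguments.
Unset Strict Implicit.
Unset Printing Implicit Defensive.
Import GRing.Theory.
Local Open Scope classical_set_scope.
Local Open Scope ring_scope.

Declare Scope lie_scope.
Delimit Scope lie_scope with lie.
Local Open Scope lie_scope.

HB.mixin Record Lmodule_isLieAlgebra (k : fieldType) L
    of GRing.Lmodule k L := {
  lie_mul : L -> L -> L;
  lie_linearl : forall (a : k) (x y z : L),
    lie_mul (a *: x + y) z = a *: lie_mul x z + lie_mul y z;
  lie_linearr : forall (a : k) (x y z : L),
    lie_mul x (a *: y + z) = a *: lie_mul x y + lie_mul x z;
  lie_mulxx : forall x : L, lie_mul x x = 0;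
  lie_jacobi : forall x y z : L,
    lie_mul x (lie_mul y z) + lie_mul y (lie_mul z x)
      + lie_mul z (lie_mul x y) = 0
}.

#[short(type="lieAlgType")]
HB.structure Definition LieAlgebra (k : fieldType) :=
  { L of Lmodule_isLieAlgebra k L & GRing.Lmodule k L }.

Notation "x ∘ y" := (lie_mul x y) (at level 40, left associativity) : lie_scope.

Definition abelian_lie (k : fieldType) (L : lieAlgType k) : Prop :=
  forall a b : L, a ∘ b = 0.

Definition metabelian (k : fieldType) (L : lieAlgType k) : Prop :=
  forall a b c d : L, (a ∘ b) ∘ (c ∘ d) = 0.

Definition lie_hom (k : fieldType) (L M : lieAlgType k) (f : L -> M) : Prop :=
  linear f /\ forall x y : L, f (x ∘ y) = f x ∘ f y.

Section Ideals.
Variables (k : fieldType) (L : lieAlgType k).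
Implicit Types (I J S : set L) (x y : L).

(* One-sided closure is enough: the product is anticommutative. *)
Definition lie_ideal I : Prop :=
  [/\ I 0,
      forall (a : k) x y, I x -> I y -> I (a *: x + y)
    & forall x y, I x -> I (x ∘ y)].

Definition ideal_gen S : set L := smallest lie_ideal S.

Definition ideal_mul I J : set L :=
  ideal_gen [set z | exists x y, [/\ I x, J y & z = x ∘ y]].

Definition commutant : set L := ideal_mul setT setT.

(* [ideal_pow I n] is the usual I^(n+1). *)
Fixpoint ideal_pow I (n : nat) : set L :=
  if n is m.+1 then ideal_mul (ideal_pow I m) I else I.

Definition nilpotent_ideal I : Prop :=
  lie_ideal I /\ exists n : nat, ideal_pow I n = [set 0].

Definition zero_divisor x : Prop :=
  x <> 0 /\
  exists y, y <> 0 /\ ideal_mul (ideal_gen [set x]) (ideal_gen [set y]) = [set 0].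

Definition zero_divisors0 : set L := [set x | x = 0 \/ zero_divisor x].

Definition fitting : set L :=
  ideal_gen [set x | exists I, nilpotent_ideal I /\ I x].

End Ideals.

Arguments commutant {k} L.
Arguments zero_divisors0 {k} L.
Arguments fitting {k} L.

Definition semidomain (k : fieldType) (L : lieAlgType k) : Prop :=
  zero_divisors0 L = fitting L.

Definition strict_semidomain (k : fieldType) (L : lieAlgType k) : Prop :=
  zero_divisors0 L = commutant L.

(* [P], with the maps [iA] and [iB], is the coproduct of [A] and [B] in the
   variety of metabelian Lie algebras; this determines [P] up to a unique
   isomorphism, and [metabelian_product_exists] below shows that it exists. *)
Definition is_metabelian_product (k : fieldType) (A B P : lieAlgType k)
    (iA : A -> P) (iB : B -> P) : Prop :=
  [/\ metabelian P, lie_hom iA, lie_hom iB &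
    forall (C : lieAlgType k) (f : A -> C) (g : B -> C),
      metabelian C -> lie_hom f -> lie_hom g ->
      exists! h : P -> C, [/\ lie_hom h, h \o iA = f & h \o iB = g]].

(* The presentation: one generator for each element of [A] and of [B], with
   all the relations that hold in [A] and in [B], modulo the identities of
   metabelian Lie algebras. *)
Section Construction.
Variables (k : fieldType) (A B : lieAlgType k).

Inductive mterm : Type :=
  | GenA of A | GenB of B | Zero
  | Add of mterm & mterm | Scale of k & mterm | Mul of mterm & mterm.

Inductive meq : mterm -> mterm -> Prop :=
  | meq_refl s : meq s s
  | meq_sym s t : meq s t -> meq t s
  | meq_trans s t u : meq s t -> meq t u -> meq s u
  | meq_Add s s' t t' : meq s s' -> meq t t' -> meq (Add s t) (Add s' t')
  | meq_Scale a s s' : meq s s' -> meq (Scale a s) (Scale a s')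
  | meq_Mul s s' t t' : meq s s' -> meq t t' -> meq (Mul s t) (Mul s' t')
  | meq_addA s t u : meq (Add s (Add t u)) (Add (Add s t) u)
  | meq_addC s t : meq (Add s t) (Add t s)
  | meq_add0 s : meq (Add Zero s) s
  | meq_addN s : meq (Add (Scale (-1) s) s) Zero
  | meq_scaleA a b s : meq (Scale a (Scale b s)) (Scale (a * b) s)
  | meq_scale1 s : meq (Scale 1 s) s
  | meq_scaleDr a s t :
      meq (Scale a (Add s t)) (Add (Scale a s) (Scale a t))
  | meq_scaleDl a b s : meq (Scale (a + b) s) (Add (Scale a s) (Scale b s))
  | meq_linearl a s t u :
      meq (Mul (Add (Scale a s) t) u) (Add (Scale a (Mul s u)) (Mul t u))
  | meq_linearr a s t u :
      meq (Mul s (Add (Scale a t) u)) (Add (Scale a (Mul s t)) (Mul s u))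
  | meq_mulxx s : meq (Mul s s) Zero
  | meq_jacobi s t u :
      meq (Add (Add (Mul s (Mul t u)) (Mul t (Mul u s))) (Mul u (Mul s t))) Zero
  | meq_metabelian s t u v : meq (Mul (Mul s t) (Mul u v)) Zero
  | meq_GenA_linear a x y :
      meq (GenA (a *: x + y)) (Add (Scale a (GenA x)) (GenA y))
  | meq_GenA_mul x y : meq (GenA (x ∘ y)) (Mul (GenA x) (GenA y))
  | meq_GenB_linear a x y :
      meq (GenB (a *: x + y)) (Add (Scale a (GenB x)) (GenB y))
  | meq_GenB_mul x y : meq (GenB (x ∘ y)) (Mul (GenB x) (GenB y)).

HB.instance Definition _ := gen_eqMixin mterm.
HB.instance Definition _ := gen_choiceMixin mterm.

Definition meqb (s t : mterm) : bool := `[< meq s t >].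

Lemma meqb_refl : reflexive meqb.
Proof. by move=> s; apply/asboolP; exact: meq_refl. Qed.

Lemma meqb_sym : symmetric meqb.
Proof. by move=> s t; apply/asboolP/asboolP; exact: meq_sym. Qed.

Lemma meqb_trans : transitive meqb.
Proof.
by move=> t s u /asboolP st /asboolP tu; apply/asboolP; exact: meq_trans tu.
Qed.

Canonical meq_equiv := EquivRel meqb meqb_refl meqb_sym meqb_trans.

Definition mprod := {eq_quot meq_equiv}%qT.
HB.instance Definition _ := Choice.on mprod.
HB.instance Definition _ := Quotient.on mprod.

Local Notation cl := (\pi_mprod%qT : mterm -> mprod).

Lemma mprodP s t : cl s = cl t <-> meq s t.
Proof.
by split=> [/eqmodP /asboolP //|st]; apply/eqmodP/asboolP.
Qed.

Lemma mprod_repr s : meq (repr (cl s)) s.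
Proof. by apply/mprodP; rewrite reprK. Qed.

Lemma mprodW (Q : mprod -> Prop) : (forall s, Q (cl s)) -> forall x, Q x.
Proof. by move=> Qcl x; rewrite -[x]reprK. Qed.

(* Locked: otherwise \pi would unify with sums and products in rewriting. *)
Definition mp_add : mprod -> mprod -> mprod :=
  locked (fun x y => cl (Add (repr x) (repr y))).
Definition mp_scale : k -> mprod -> mprod :=
  locked (fun a x => cl (Scale a (repr x))).
Definition mp_mul : mprod -> mprod -> mprod :=
  locked (fun x y => cl (Mul (repr x) (repr y))).

Lemma mp_addE s t : mp_add (cl s) (cl t) = cl (Add s t).
Proof.
by rewrite /mp_add; unlock; apply/mprodP/meq_Add; exact: mprod_repr.
Qed.

Lemma mp_scaleE a s : mp_scale a (cl s) = cl (Scale a s).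
Proof.
by rewrite /mp_scale; unlock; apply/mprodP/meq_Scale; exact: mprod_repr.
Qed.

Lemma mp_mulE s t : mp_mul (cl s) (cl t) = cl (Mul s t).
Proof.
by rewrite /mp_mul; unlock; apply/mprodP/meq_Mul; exact: mprod_repr.
Qed.

Let mpE := (mp_addE, mp_scaleE, mp_mulE).

Lemma mp_addA : associative mp_add.
Proof.
elim/mprodW=> s; elim/mprodW=> t; elim/mprodW=> u.
by rewrite !mpE; apply/mprodP/meq_addA.
Qed.

Lemma mp_addC : commutative mp_add.
Proof.
by elim/mprodW=> s; elim/mprodW=> t; rewrite !mpE; apply/mprodP/meq_addC.
Qed.

Lemma mp_add0 : left_id (cl Zero) mp_add.
Proof. by elim/mprodW=> s; rewrite !mpE; apply/mprodP/meq_add0. Qed.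

Lemma mp_addN : left_inverse (cl Zero) (mp_scale (-1)) mp_add.
Proof. by elim/mprodW=> s; rewrite !mpE; apply/mprodP/meq_addN. Qed.

HB.instance Definition _ :=
  GRing.isZmodule.Build mprod mp_addA mp_addC mp_add0 mp_addN.

Lemma mp_scaleA a b x : mp_scale a (mp_scale b x) = mp_scale (a * b) x.
Proof. by elim/mprodW: x => s; rewrite !mpE; apply/mprodP/meq_scaleA. Qed.

Lemma mp_scale1 : left_id 1 mp_scale.
Proof. by elim/mprodW=> s; rewrite !mpE; apply/mprodP/meq_scale1. Qed.

Lemma mp_scaleDr : right_distributive mp_scale +%R.
Proof.
move=> a; elim/mprodW=> s; elim/mprodW=> t.
by rewrite -[LHS]/(mp_scale a (mp_add _ _)) -[RHS]/(mp_add _ _) !mpE;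
   apply/mprodP/meq_scaleDr.
Qed.

Lemma mp_scaleDl x : {morph mp_scale^~ x : a b / a + b}.
Proof.
move=> a b /=; elim/mprodW: x => s.
by rewrite -[RHS]/(mp_add _ _) !mpE; apply/mprodP/meq_scaleDl.
Qed.

HB.instance Definition _ := GRing.Zmodule_isLmodule.Build k mprod
  mp_scaleA mp_scale1 mp_scaleDr mp_scaleDl.

Lemma cl0 : (0 : mprod) = cl Zero. Proof. by []. Qed.
Lemma clD s t : cl s + cl t = cl (Add s t). Proof. exact: mp_addE. Qed.
Lemma clZ a s : a *: cl s = cl (Scale a s). Proof. exact: mp_scaleE. Qed.

Let clE := (clD, clZ, mp_mulE, cl0).

Lemma mp_linearl (a : k) (x y z : mprod) :
  mp_mul (a *: x + y) z = a *: mp_mul x z + mp_mul y z.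
Proof.
elim/mprodW: x => s; elim/mprodW: y => t; elim/mprodW: z => u.
by rewrite !clE; apply/mprodP/meq_linearl.
Qed.

Lemma mp_linearr (a : k) (x y z : mprod) :
  mp_mul x (a *: y + z) = a *: mp_mul x y + mp_mul x z.
Proof.
elim/mprodW: x => s; elim/mprodW: y => t; elim/mprodW: z => u.
by rewrite !clE; apply/mprodP/meq_linearr.
Qed.

Lemma mp_mulxx (x : mprod) : mp_mul x x = 0.
Proof. by elim/mprodW: x => s; rewrite !clE; apply/mprodP/meq_mulxx. Qed.

Lemma mp_jacobi (x y z : mprod) :
  mp_mul x (mp_mul y z) + mp_mul y (mp_mul z x) + mp_mul z (mp_mul x y) = 0.
Proof.
elim/mprodW: x => s; elim/mprodW: y => t; elim/mprodW: z => u.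
by rewrite !clE; apply/mprodP/meq_jacobi.
Qed.

HB.instance Definition _ := Lmodule_isLieAlgebra.Build k mprod
  mp_linearl mp_linearr mp_mulxx mp_jacobi.

Lemma clM s t : cl s ∘ cl t = cl (Mul s t). Proof. exact: mp_mulE. Qed.

Definition mp_inA (x : A) : mprod := cl (GenA x).
Definition mp_inB (x : B) : mprod := cl (GenB x).

Section Universal.
Variables (C : lieAlgType k) (f : A -> C) (g : B -> C).
Hypotheses (metaC : metabelian C) (hf : lie_hom f) (hg : lie_hom g).

Fixpoint meval (t : mterm) : C :=
  match t with
  | GenA x => f x
  | GenB x => g x
  | Zero => 0
  | Add s t => meval s + meval t
  | Scale a s => a *: meval s
  | Mul s t => meval s ∘ meval t
  end.

Lemma meval_meq s t : meq s t -> meval s = meval t.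
Proof.
have [[fl fM] [gl gM]] := (hf, hg).
elim=> {s t} //=.
- by move=> s t u _ -> _ ->.
- by move=> s s' t t' _ -> _ ->.
- by move=> a s s' _ ->.
- by move=> s s' t t' _ -> _ ->.
- by move=> *; rewrite addrA.
- by move=> *; rewrite addrC.
- by move=> *; rewrite add0r.
- by move=> s; rewrite scaleN1r addNr.
- by move=> *; rewrite scalerA.
- by move=> *; rewrite scale1r.
- by move=> *; rewrite scalerDr.
- by move=> *; rewrite scalerDl.
- by move=> *; rewrite lie_linearl.
- by move=> *; rewrite lie_linearr.
- by move=> *; rewrite lie_mulxx.
- by move=> *; rewrite lie_jacobi.
Qed.

Definition mp_lift (x : mprod) : C := meval (repr x).

Lemma mp_liftE s : mp_lift (cl s) = meval s.
Proof. exact/meval_meq/mprod_repr. Qed.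

Lemma mp_lift_hom : lie_hom mp_lift.
Proof.
split=> [a|]; elim/mprodW=> s; elim/mprodW=> t.
- by rewrite clZ clD !mp_liftE.
- by rewrite clM !mp_liftE.
Qed.

Lemma mp_lift_unique (h : mprod -> C) :
  lie_hom h -> h \o mp_inA = f -> h \o mp_inB = g -> mp_lift = h.
Proof.
move=> [hl hM] hA hB; apply/funext; elim/mprodW=> s; rewrite mp_liftE.
have h0 : h 0 = 0.
  by have := hl (-1) 0 0; rewrite scaler0 addr0 scaleN1r addNr.
elim: s => /= [x|x||s -> t ->|a s ->|s -> t ->].
- by rewrite -hA.
- by rewrite -hB.
- by rewrite -cl0.
- by rewrite -clD -[cl s]scale1r hl !scale1r.
- by rewrite -clZ -[a *: cl s]addr0 hl h0 addr0.
- by rewrite -clM hM.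
Qed.

End Universal.

Lemma mprod_is_metabelian_product : is_metabelian_product mp_inA mp_inB.
Proof.
split.
- elim/mprodW=> s; elim/mprodW=> t; elim/mprodW=> u; elim/mprodW=> v.
  by rewrite !clM cl0; apply/mprodP/meq_metabelian.
- split=> [a x y|x y]; rewrite /mp_inA ?clM ?clZ ?clD; apply/mprodP.
  + exact: meq_GenA_linear.
  + exact: meq_GenA_mul.
- split=> [a x y|x y]; rewrite /mp_inB ?clM ?clZ ?clD; apply/mprodP.
  + exact: meq_GenB_linear.
  + exact: meq_GenB_mul.
- move=> C f g metaC hf hg; exists (mp_lift f g); split; last first.
    by move=> h [hh hA hB]; exact: mp_lift_unique.
  split; first exact: mp_lift_hom.
  + by apply/funext=> x /=; rewrite mp_liftE.
  + by apply/funext=> x /=; rewrite mp_liftE.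
Qed.

End Construction.

Lemma metabelian_product_exists (k : fieldType) (A B : lieAlgType k) :
  exists (P : lieAlgType k) (iA : A -> P) (iB : B -> P),
    is_metabelian_product iA iB.
Proof.
exists (mprod A B : lieAlgType k), (@mp_inA k A B), (@mp_inB k A B).
exact: mprod_is_metabelian_product.
Qed.

(* Main.v *)
Require Import Defs.
From HB Require Import structures.
From mathcomp Require Import all_boot all_order all_algebra.
From mathcomp Require Import boolp classical_sets.
From mathcomp Require Import functions wochoice.
Set Implicit Arguments.
Unset Strict Implicit.
Unset Printing Implicit Defensive.
Import GRing.Theory.
Local Open Scope ring_scope.
Local Open Scope lie_scope.

(** Let L be metabelian, with commutant L^2. On L^2 the operators [ad x] commute,
    so L^2 is a module over the symmetric algebra of L/L^2. Elements of L^2 are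
    always zero divisors and lie in the Fitting radical. The point is therefore
    whether an element outside L^2 can kill a nonzero element of L^2; if none
    does, L is called regular below ([regular_outside]). An algebra that is
    abelian or a strict semidomain is regular, and a regular algebra with
    nonzero commutant satisfies D(L) = L^2 = Fit(L) ([regular_semidomain]).

    Necessity. If A is neither abelian nor a strict semidomain, some x outside
    A^2 kills some nonzero c in A^2 ([nonregular_witness]). Then x remains a zero
    divisor in the product P, which contains A. But no power of [ad x] kills
    P^2: this is visible after mapping P to the two-dimensional nonabelian
    algebra ([iter_lie_bracket_neq0]). As elements of the Fitting radical act
    nilpotently on P^2 ([fitting_ad_nilpotent]), P is not a semidomain.

    Sufficiency amounts to [product_regular]: if A and B are regular, so is P.
    Write U = A/A^2 and V = B/B^2, and choose ordered bases of both. As an ideal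
    of P, P^2 is filtered by A^2 k[V] + B^2 k[U], and the quotient is the part of
    k[U + V] spanned by the monomials that involve both U and V. Accordingly an
    element of P^2 is a sum y0 + yA + yB ([commutant_normal_form]). To see that
    the coefficients in this sum are determined, and to follow the action of x
    on them, P is mapped to semidirect products of A * B by modules of power
    series, in other words, derivations of P are constructed; by the universal
    property these are pairs of derivations of A and of B ([prod_derivation]).
    With coefficients in k[[U]] such a derivation sees y0 and kills the rest
    ([cross_part_eq0]). With coefficients in a module that contains A^2 and to
    which the inclusion of A^2 extends as a derivation of A
    ([magnus_embedding], the additive form of the Magnus embedding), it sees
    yA and kills yB ([ideal_part_eq0]). In each case x acts as u + v with u in U
    and v in V not both zero; if u is nonzero it is injective on coefficients
    while v raises the degree, and otherwise v is a variable up to a change of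
    basis: so x acts injectively ([series_act_inj]). *)

(** * Linear maps and subspaces *)

Section LinearMaps.
Variables (k : fieldType) (V W : lmodType k) (f : V -> W).
Hypothesis fL : linear f.

Lemma linD x y : f (x + y) = f x + f y.
Proof. by rewrite -[x in LHS]scale1r fL scale1r. Qed.

Lemma lin0 : f 0 = 0.
Proof. by apply: (addrI (f 0)); rewrite -linD !addr0. Qed.

Lemma linZ a x : f (a *: x) = a *: f x.
Proof. by rewrite -[a *: x]addr0 fL lin0 addr0. Qed.

Lemma linN x : f (- x) = - f x.
Proof. by rewrite -scaleN1r linZ scaleN1r. Qed.

Lemma linB x y : f (x - y) = f x - f y.
Proof. by rewrite linD linN. Qed.

Lemma lin_sum (J : Type) (s : seq J) (F : J -> V) :
  f (\sum_(j <- s) F j) = \sum_(j <- s) f (F j).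
Proof.
by elim: s => [|j s IH]; rewrite ?big_nil ?lin0 // !big_cons linD IH.
Qed.

End LinearMaps.

Lemma lin_comp (k : fieldType) (U V W : lmodType k) (f : V -> W) (g : U -> V) :
  linear f -> linear g -> linear (fun x => f (g x)).
Proof. by move=> fL gL a x y; rewrite gL fL. Qed.

Definition submod (k : fieldType) (V : lmodType k) (D : set V) : Prop :=
  D 0 /\ forall (a : k) x y, D x -> D y -> D (a *: x + y).

Section Submodules.
Variables (k : fieldType) (V : lmodType k) (D : set V).
Hypothesis sD : submod D.

Lemma submodD x y : D x -> D y -> D (x + y).
Proof. by move=> Dx Dy; rewrite -[x]scale1r; apply: sD.2. Qed.

Lemma submodZ a x : D x -> D (a *: x).
Proof. by move=> Dx; rewrite -[_ *: _]addr0; apply: sD.2 => //; exact: sD.1. Qed.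

Lemma submodN x : D x -> D (- x).
Proof. by rewrite -scaleN1r; apply: submodZ. Qed.

Lemma submodB x y : D x -> D y -> D (x - y).
Proof. by move=> Dx Dy; apply: submodD => //; apply: submodN. Qed.

Lemma submod_sum (J : eqType) (s : seq J) (F : J -> V) :
  (forall j, j \in s -> D (F j)) -> D (\sum_(j <- s) F j).
Proof.
move=> DF; rewrite big_seq; elim/big_rec: _ => [|j x js Dx]; first exact: sD.1.
by apply: submodD => //; apply: DF.
Qed.

End Submodules.

Lemma submod_preim (k : fieldType) (V W : lmodType k) (f : V -> W) (D : set W) :
  linear f -> submod D -> submod (fun x => D (f x)).
Proof.
move=> fL sD; split=> [|a x y Dx Dy]; first by rewrite lin0 //; exact: sD.1.
by rewrite fL; apply: sD.2.
Qed.

Lemma submod_eq (k : fieldType) (V W : lmodType k) (f g : V -> W) :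
  linear f -> linear g -> submod (fun x => f x = g x).
Proof.
by move=> fL gL; split=> [|a x y /= fx fy]; rewrite ?lin0 // fL gL fx fy.
Qed.

Lemma submod_ker (k : fieldType) (V W : lmodType k) (f : V -> W) :
  linear f -> submod (fun x => f x = 0).
Proof.
by move=> fL; split=> [|a x y /= fx fy]; rewrite ?lin0 // fL fx fy scaler0 addr0.
Qed.

(** * Bases modulo a subspace *)

Definition free_mod (k : fieldType) (V : lmodType k) (D : set V)
    (I : eqType) (e : I -> V) : Prop :=
  forall (s : seq I) (c : I -> k), uniq s ->
    D (\sum_(i <- s) c i *: e i) -> forall i, i \in s -> c i = 0.

Definition basis_mod (k : fieldType) (V : lmodType k) (D : set V)
    (I : eqType) (e : I -> V) : Prop :=
  free_mod D e /\
  forall S : set V, submod S -> (forall x, D x -> S x) -> (forall i, S (e i)) ->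
    forall x, S x.

Lemma big_support (V : nmodType) (I : eqType) (s t : seq I) (F : I -> V) :
  uniq s -> uniq t -> {subset s <= t} -> (forall i, i \notin s -> F i = 0) ->
  \sum_(i <- s) F i = \sum_(i <- t) F i.
Proof.
move=> us ut st F0; rewrite [RHS](bigID (mem s)) /=.
rewrite [X in _ + X]big1 ?addr0; last by move=> i /F0.
rewrite -[RHS]big_filter; apply: perm_big; apply: uniq_perm => //.
  by rewrite filter_uniq.
by move=> i; rewrite mem_filter andb_idr // => /st.
Qed.

Section LinearExtension.
Variables (k : fieldType) (V : lmodType k) (D : set V) (I : eqType) (e : I -> V).
Hypotheses (sD : submod D) (eB : basis_mod D e).

(** Coefficients vanish off [s], so that two expansions can be compared over a
    common support. *)
Definition expansion x (s : seq I) (c : I -> k) : Prop :=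
  [/\ uniq s, forall i, i \notin s -> c i = 0 & D (x - \sum_(i <- s) c i *: e i)].

Lemma big_supportU (N : lmodType k) (F : I -> N) (s t : seq I) (a : k)
    (c d : I -> k) :
  uniq s -> (forall i, i \notin s -> c i = 0) ->
  uniq t -> (forall i, i \notin t -> d i = 0) ->
  \sum_(i <- undup (s ++ t)) (a * c i + d i) *: F i =
    a *: (\sum_(i <- s) c i *: F i) + \sum_(i <- t) d i *: F i.
Proof.
move=> us c0 ut d0; have uu := undup_uniq (s ++ t).
rewrite (big_support us uu) ?(big_support ut uu); first last.
- by move=> i /c0 ->; rewrite scale0r.
- by move=> i; rewrite mem_undup mem_cat => ->.
- by move=> i /d0 ->; rewrite scale0r.
- by move=> i; rewrite mem_undup mem_cat orbC => ->.
rewrite scaler_sumr -big_split /=; apply: eq_bigr => i _.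
by rewrite scalerDl scalerA.
Qed.

Lemma expansion_lin a x y s t c d : expansion x s c -> expansion y t d ->
  expansion (a *: x + y) (undup (s ++ t)) (fun i => a * c i + d i).
Proof.
move=> [us c0 Dx] [ut d0 Dy]; split; first exact: undup_uniq.
  move=> i; rewrite mem_undup mem_cat negb_or => /andP[/c0 -> /d0 ->].
  by rewrite mulr0 addr0.
by rewrite big_supportU // opprD addrACA -scalerBr; exact: sD.2.
Qed.

Lemma expansion_ker x : D x -> expansion x [::] (fun=> 0).
Proof. by move=> Dx; split=> //; rewrite big_nil subr0. Qed.

Lemma expansion_vec i : expansion (e i) [:: i] (fun j => (j == i)%:R).
Proof.
split=> // [j|]; first by rewrite inE => /negbTE ->.
by rewrite big_seq1 eqxx scale1r subrr; exact: sD.1.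
Qed.

Lemma expansion_ex x : exists s c, expansion x s c.
Proof.
move: x; apply: eB.2.
- split=> [|a x y [s [c sc]] [t [d td]]].
    by exists [::], (fun=> 0); apply: expansion_ker; exact: sD.1.
  by exists (undup (s ++ t)), (fun i => a * c i + d i); apply: expansion_lin.
- by move=> x /expansion_ker; exists [::], (fun=> 0).
- by move=> i; exists [:: i], (fun j => (j == i)%:R); exact: expansion_vec.
Qed.

Lemma expansion_eq (N : lmodType k) (F : I -> N) x s t c d :
  expansion x s c -> expansion x t d ->
  \sum_(i <- s) c i *: F i = \sum_(i <- t) d i *: F i.
Proof.
move=> sc td; have [us c0 _] := sc; have [ut d0 _] := td.
have [uu _] := expansion_lin (-1) sc td.
rewrite scaleN1r addNr sub0r => /(submodN sD); rewrite opprK => D0.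
apply/esym/eqP; rewrite -subr_eq0 addrC -scaleN1r -big_supportU //.
rewrite big_seq big1 // => i ist.
by rewrite (eB.1 _ (fun i => -1 * c i + d i) uu D0 i ist) scale0r.
Qed.

(** The value at a vector is read off any of its expansions; freeness makes it
    independent of the choice. *)
Lemma lin_ext_ex (N : lmodType k) (F : I -> N) :
  exists f : V -> N, [/\ linear f, forall i, f (e i) = F i
                       & forall x, D x -> f x = 0].
Proof.
have /choice[h hE] x : exists p, expansion x p.1 p.2.
  by have [s [c H]] := expansion_ex x; exists (s, c).
exists (fun x => \sum_(i <- (h x).1) (h x).2 i *: F i); split.
- move=> a x y; have [[ux x0 _] [uy y0 _]] := (hE x, hE y).
  rewrite -big_supportU //; apply: expansion_eq (hE _) _.
  exact: expansion_lin.
- move=> i; rewrite (expansion_eq F (hE _) (expansion_vec i)) big_seq1.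
  by rewrite eqxx scale1r.
- by move=> x /expansion_ker /(expansion_eq F (hE x)) ->; rewrite big_nil.
Qed.

Definition lext (N : lmodType k) (F : I -> N) : V -> N :=
  sval (cid (lin_ext_ex F)).

Lemma lext_lin (N : lmodType k) (F : I -> N) : linear (lext F).
Proof. by rewrite /lext; case: cid => f []. Qed.

Lemma lextE (N : lmodType k) (F : I -> N) i : lext F (e i) = F i.
Proof. by rewrite /lext; case: cid => f []. Qed.

Lemma lext_ker (N : lmodType k) (F : I -> N) x : D x -> lext F x = 0.
Proof. by rewrite /lext; case: cid => f [fL fe fD]; exact: fD. Qed.

Lemma lin_ext_eq (N : lmodType k) (f g : V -> N) : linear f -> linear g ->
  (forall x, D x -> f x = g x) -> (forall i, f (e i) = g (e i)) -> f =1 g.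
Proof. by move=> fL gL; apply: eB.2; exact: submod_eq. Qed.

End LinearExtension.

Section BasisExistence.
Variables (k : fieldType) (V : lmodType k) (D : set V).
Hypothesis sD : submod D.
Local Open Scope classical_set_scope.

Let indep (E : set V) : Prop := forall (s : seq V) (c : V -> k),
  uniq s -> (forall x, x \in s -> E x) -> D (\sum_(x <- s) c x *: x) ->
  forall x, x \in s -> c x = 0.

(** Zorn's lemma: a dependence relation involves finitely many vectors, so in
    the union of a chain it already occurs in one member. *)
Let max_indep E0 : indep E0 -> exists E : set V,
  [/\ indep E, E0 `<=` E & forall x, indep (E `|` [set x]) -> E x].
Proof.
move=> iE0.
have [F FP Ftot|E [iE Emax]] := @Zorn_bigcup V (fun E => indep (E0 `|` E)).
  move=> s c us sF.
  suff [sE0|[E FE sE]] : (forall x, x \in s -> E0 x) \/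
      exists2 E, F E & forall x, x \in s -> (E0 `|` E) x.
  - exact: iE0.
  - exact: (FP _ FE).
  elim: s {us} sF => [|y s IH] sF; first by left.
  have sF' x : x \in s -> (E0 `|` \bigcup_(X in F) X) x.
    by move=> xs; apply: sF; rewrite inE xs orbT.
  have [y0|[Y FY Yy]] := sF y (mem_head _ _);
    have [sE0|[E FE sE]] := IH sF'.
  - by left=> x; rewrite inE => /predU1P[->|/sE0].
  - by right; exists E => // x; rewrite inE => /predU1P[->|/sE]; [left|].
  - right; exists Y => // x; rewrite inE => /predU1P[->|/sE0]; first by right.
    by left.
  - have [EY|YE] := Ftot _ _ FE FY.
    + right; exists Y => // x; rewrite inE => /predU1P[->|/sE]; first by right.
      by case; [left | move=> /EY; right].
    + right; exists E => // x; rewrite inE => /predU1P[->|/sE] //.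
      by right; apply: YE.
exists (E0 `|` E); split=> // x iEx.
apply: contrapT => nEx; apply: (Emax (E `|` [set x])); last by rewrite setUA.
split; first by move=> y Ey; left.
by move=> sub; apply: nEx; right; apply: sub; right.
Qed.

(** A relation that forbids adding [x] to [E] has a nonzero coefficient at [x],
    hence expresses [x] through [E]. *)
Let indep_span E : indep E -> (forall x, indep (E `|` [set x]) -> E x) ->
  forall S : set V, submod S -> D `<=` S -> E `<=` S -> forall x, S x.
Proof.
move=> iE Emax S sS DS ES x; have [/ES//|nEx] := pselect (E x).
apply: contrapT => nSx; apply: nEx; apply: Emax => s c us sE Ds.
have sE' y : y \in s -> y != x -> E y.
  by move=> /sE[//|->]; rewrite eqxx.
have cx0 : x \in s -> c x = 0.
  move=> xs; apply/eqP; apply: contrapT => /negP cx; apply: nSx.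
  have -> : x = (c x)^-1 *: (c x *: x) by rewrite scalerA mulVf // scale1r.
  apply: submodZ => //.
  rewrite (bigD1_seq x) //= in Ds.
  rewrite -[_ *: x](addrK (\sum_(y <- s | y != x) c y *: y)).
  apply: submodB => //; first exact: DS.
  rewrite -big_filter; apply: submod_sum => // y.
  rewrite mem_filter => /andP[yx ys]; apply: submodZ => //.
  by apply: ES; apply: sE'.
move=> y ys; have [yx|yx] := eqVneq y x.
  by rewrite yx; apply: cx0; rewrite -yx.
(* Without its vanishing coefficient at [x], the relation is one within [E]. *)
apply: (iE (rem x s) c) => [|z||]; rewrite ?rem_uniq //.
- by rewrite mem_rem_uniq // => /andP[/= zx /sE']; apply.
- rewrite rem_filter // big_filter; move: Ds; have [xs|xs] := boolP (x \in s).
    by rewrite (bigD1_seq x) //= cx0 // scale0r add0r.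
  congr D; rewrite big_seq_cond [RHS]big_seq_cond; apply: eq_bigl => z /=.
  by have [->|] := eqVneq z x; rewrite ?(negbTE xs) ?andbT.
- by rewrite mem_rem_uniq //= inE yx.
Qed.

(** The maximal independent set is grown from [x0]. Having [x0] itself in the
    basis makes its action on monomials a plain shift. *)
Lemma basis_mod_ex x0 : exists (I : choiceType) (e : I -> V),
  basis_mod D e /\ (D x0 \/ exists i, e i = x0).
Proof.
have [E [iE Emax Ex0]] : exists E : set V, [/\ indep E,
    forall x, indep (E `|` [set x]) -> E x & ~ D x0 -> E x0].
  have [Dx0|nDx0] := pselect (D x0).
    have [|E [iE _ Emax]] := @max_indep set0; last by exists E.
    by move=> [|y s] c //= us /(_ y (mem_head _ _)).
  have [|E [iE x0E Emax]] := @max_indep [set x0]; last first.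
    by exists E; split=> // _; apply: x0E.
  move=> s c us sx0 Ds x xs; have xx0 : x = x0 := sx0 x xs.
  apply/eqP; apply: contrapT => /negP cx; apply: nDx0.
  have -> : x0 = (c x)^-1 *: (c x *: x) by rewrite scalerA mulVf // scale1r.
  apply: submodZ => //; suff <- : \sum_(y <- s) c y *: y = c x *: x by [].
  rewrite (bigD1_seq x) //= big_seq_cond big1 ?addr0 // => y /andP[ys].
  by rewrite xx0 (sx0 y ys) eqxx.
exists {x : V | `[< E x >]}, (fun i => val i); split; last first.
  have [Dx0|/Ex0/asboolP Ex0'] := pselect (D x0); [by left|right].
  by exists (exist _ x0 Ex0').
split=> [s c us Ds i si|S sS DS ES].
  pose c' x := if insub x is Some i then c i else 0.
  have c'E j : c' (val j) = c j by rewrite /c' valK.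
  rewrite -c'E; apply: (iE (map val s)).
  - by rewrite map_inj_uniq //; exact: val_inj.
  - by move=> _ /mapP[j _ ->]; apply/asboolP; exact: (valP j).
  - by rewrite big_map; under eq_bigr do rewrite c'E.
  - exact: map_f.
apply: (indep_span iE Emax) => // x /asboolP Ex; exact: (ES (exist _ x Ex)).
Qed.

End BasisExistence.

(** * Linear orders and sorted monomials *)

Definition linear_order (T : eqType) (le : rel T) : Prop :=
  [/\ total le, transitive le & antisymmetric le].

Lemma linear_order_ex (T : eqType) : exists R : rel T, linear_order R.
Proof.
have [R wR] := well_ordering_principle T.
have wRT : @wo_chain T R predT by move=> A _; exact: wR.
have Rtot : total R by move=> x y; exact: (wo_chainW wRT).
have Ranti : antisymmetric R.
  by move=> x y; exact: (wo_chain_antisymmetric wRT).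
exists R; split=> // y x z xy yz.
(* Transitivity: compare the three elements with the least of them. *)
have [m [[]]] : exists! m, minimum_of R [pred u | u \in [:: x; y; z]] m.
  by apply: wR; exists x; rewrite !inE eqxx.
move=> m3 mR _; have [mx my mz] : [/\ R m x, R m y & R m z].
  by split; apply: mR; rewrite !inE eqxx ?orbT.
move: m3; rewrite !inE => /or3P[] /eqP mE; first by rewrite -mE.
- by rewrite (Ranti x y) // xy -mE mx.
- have yzE : y = z by apply: Ranti; rewrite yz -mE.
  by rewrite -yzE.
Qed.

Section Sorting.
Variables (T : eqType) (le : rel T).
Hypothesis lo : linear_order le.
Implicit Types (s t : seq T).

Lemma sort_eqP s t : reflect (sort le s = sort le t) (perm_eq s t).
Proof. by case: lo => *; exact: perm_sortP. Qed.

Lemma sort_is_sorted s : sorted le (sort le s).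
Proof. by case: lo => *; exact: sort_sorted. Qed.

Lemma sort_id s : sorted le s -> sort le s = s.
Proof. by case: lo => *; exact: sorted_sort. Qed.

Lemma sort_cons_sort x s : sort le (x :: sort le s) = sort le (x :: s).
Proof. by apply/sort_eqP; rewrite perm_cons perm_sort. Qed.

Lemma sort_cons x s : all (le x) s -> sort le (x :: s) = x :: sort le s.
Proof.
case: lo => tot tr anti xs; apply: (sorted_eq tr anti).
- exact: sort_is_sorted.
- by rewrite /= path_sortedE // sort_is_sorted // all_sort xs.
- by rewrite perm_sort perm_cons perm_sym perm_sort.
Qed.

Lemma sort_insert x y s : all (le y) s -> le y x ->
  sort le (x :: y :: s) = y :: sort le (x :: s).
Proof.
move=> ys yx; rewrite -sort_cons /= ?yx //.
by apply/sort_eqP/permPl; exact: (perm_catCA [:: x] [:: y] s).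
Qed.

Lemma not_le x y : ~~ le x y -> le y x.
Proof. by case: lo => tot _ _; have := tot x y; case: (le x y). Qed.

Lemma all_le_trans x y s : le x y -> all (le y) s -> all (le x) s.
Proof. by case: lo => _ tr _ xy; apply: sub_all => z; exact: tr. Qed.

Lemma sorted_perm_eq s t :
  sorted le s -> sorted le t -> perm_eq s t = (s == t).
Proof.
move=> ss st; apply/idP/eqP => [/sort_eqP|-> //].
by rewrite !sort_id.
Qed.

End Sorting.

(** * Calculus in Lie algebras *)

Section LieCalculus.
Variables (k : fieldType) (L : lieAlgType k).
Implicit Types (x y z : L) (a : k).

Lemma lie_linl y : linear (fun x : L => x ∘ y).
Proof. by move=> a x z; exact: lie_linearl. Qed.

Lemma lie_linr x : linear (lie_mul x).
Proof. by move=> a y z; exact: lie_linearr. Qed.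

Definition lieDl x y z : (x + y) ∘ z = x ∘ z + y ∘ z := linD (lie_linl z) x y.
Definition lieDr x y z : x ∘ (y + z) = x ∘ y + x ∘ z := linD (lie_linr x) y z.
Definition lieNr x y : x ∘ (- y) = - (x ∘ y) := linN (lie_linr x) y.
Definition lie0l x : 0 ∘ x = 0 := lin0 (lie_linl x).
Definition lie0r x : x ∘ 0 = 0 := lin0 (lie_linr x).

Lemma lieC x y : x ∘ y = - (y ∘ x).
Proof.
apply/eqP; rewrite -addr_eq0; apply/eqP.
by have := lie_mulxx (x + y); rewrite lieDl !lieDr !lie_mulxx add0r addr0.
Qed.

Lemma lie_leibniz x y z : x ∘ (y ∘ z) = (x ∘ y) ∘ z + y ∘ (x ∘ z).
Proof.
have := lie_jacobi x y z; rewrite (lieC z x) lieNr (lieC z (x ∘ y)).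
by move=> /eqP; rewrite -addrA -opprD subr_eq0 addrC => /eqP.
Qed.

Lemma ideal_submod (I : set L) : lie_ideal I -> submod I.
Proof. by case. Qed.

Lemma ideal_gen_ideal (S : set L) : lie_ideal (ideal_gen S).
Proof.
split=> [I [[]]//|a x y Sx Sy I IS|x y Sx I IS].
- by case: (IS) => -[_ + _] _; apply; [exact: Sx|exact: Sy].
- by case: (IS) => -[_ _ +] _; apply; exact: Sx.
Qed.

Lemma ideal_gen_in (S : set L) x : S x -> ideal_gen S x.
Proof. by move=> Sx I [_]; apply. Qed.

Lemma ideal_gen_sub (S I : set L) :
  lie_ideal I -> (forall x, S x -> I x) -> forall x, ideal_gen S x -> I x.
Proof. by move=> idI SI x; apply. Qed.

Lemma ideal_mul_in (I J : set L) x y : I x -> J y -> ideal_mul I J (x ∘ y).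
Proof. by move=> Ix Jy; apply: ideal_gen_in; exists x, y. Qed.

Lemma ideal0 : lie_ideal [set (0 : L)]%classic.
Proof.
split=> // [a x y -> ->|x y ->]; first by rewrite scaler0 addr0.
by rewrite lie0l.
Qed.

Lemma ideal_mul_eq0 (I J : set L) : (forall x y, I x -> J y -> x ∘ y = 0) ->
  ideal_mul I J = [set 0]%classic.
Proof.
move=> IJ0; apply/seteqP; split=> [|_ ->].
  by apply: ideal_gen_sub ideal0 _ => _ [x [y [Ix Jy ->]]]; exact: IJ0.
by have [] := ideal_gen_ideal [set z | exists x y, [/\ I x, J y & z = x ∘ y]]%classic.
Qed.

Lemma ideal_mul0P (I J : set L) x y :
  ideal_mul I J = [set 0]%classic -> I x -> J y -> x ∘ y = 0.
Proof. by move=> IJ0 Ix Jy; have := ideal_mul_in Ix Jy; rewrite IJ0. Qed.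

Lemma commutant_ideal : lie_ideal (commutant L).
Proof. exact: ideal_gen_ideal. Qed.

Lemma commutant_submod : submod (commutant L).
Proof. exact/ideal_submod/commutant_ideal. Qed.

Lemma commutantM x y : commutant L (x ∘ y).
Proof. exact: ideal_mul_in. Qed.

(** The span of the brackets is already closed under further brackets, which
    makes the commutant amenable to linear induction. *)
Lemma commutant_min (S : set L) : submod S -> (forall x y, S (x ∘ y)) ->
  forall x, commutant L x -> S x.
Proof.
move=> [S0 Slin] SM; suff H x : commutant L x -> S x /\ commutant L x by move=> x /H[].
apply: (ideal_gen_sub (I := fun x => S x /\ commutant L x)).
  split=> [|a y z [Sy Cy] [Sz Cz]|y z [Sy Cy]].
  - by split=> //; exact: commutant_submod.1.
  - by split; [exact: Slin | exact: commutant_submod.2].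
  - by split; [exact: SM | exact: commutantM].
by move=> _ [y [z [_ _ ->]]]; split; [exact: SM | exact: commutantM].
Qed.

End LieCalculus.

Lemma hom_commutant (k : fieldType) (C D : lieAlgType k) (f : C -> D) c :
  lie_hom f -> commutant C c -> commutant D (f c).
Proof.
move=> [fL fM]; move: c; apply: commutant_min => [|x y].
  exact: submod_preim fL (commutant_submod D).
by rewrite fM; exact: commutantM.
Qed.

(** The shape that torsion-freeness takes for a metabelian algebra: the
    commutant has no torsion with respect to linear forms. *)
Definition regular_outside (k : fieldType) (L : lieAlgType k) : Prop :=
  forall x c : L, ~ commutant L x -> commutant L c -> x ∘ c = 0 -> c = 0.

Section Metabelian.
Variables (k : fieldType) (L : lieAlgType k).
Hypothesis mL : metabelian L.
Implicit Types x y c d : L.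

Lemma commutant_abelian c d : commutant L c -> commutant L d -> c ∘ d = 0.
Proof.
move=> + Cd; move: c; apply: commutant_min; first exact: submod_ker (lie_linl d).
move=> x y; move: d Cd; apply: commutant_min => [|u v]; last exact: mL.
exact: submod_ker (lie_linr _).
Qed.

(** The two sides differ by the action of [x ∘ y], an element of the abelian
    ideal [commutant L]: the commutant is a module over a polynomial ring. *)
Lemma adjoint_comm x y c : commutant L c -> x ∘ (y ∘ c) = y ∘ (x ∘ c).
Proof.
move=> Cc; rewrite lie_leibniz commutant_abelian ?add0r //; exact: commutantM.
Qed.

End Metabelian.

Fixpoint ad_mon (k : fieldType) (L : lieAlgType k) (I : Type) (g : I -> L)
    (s : seq I) (z : L) : L :=
  if s is i :: s' then g i ∘ ad_mon g s' z else z.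

Section Monomials.
Variables (k : fieldType) (L : lieAlgType k).
Implicit Types x c : L.

Lemma ad_mon_lin (I : Type) (g : I -> L) s : linear (ad_mon g s).
Proof. by elim: s => //= i s IH a x y; rewrite IH lie_linearr. Qed.

Lemma ad_mon_commutant (I : Type) (g : I -> L) s c :
  commutant L c -> commutant L (ad_mon g s c).
Proof. by move=> Cc; elim: s => //= i s _; exact: commutantM. Qed.

Lemma ad_mon_cat (I : Type) (g : I -> L) s t c :
  ad_mon g (s ++ t) c = ad_mon g s (ad_mon g t c).
Proof. by elim: s => //= i s ->. Qed.

Hypothesis mL : metabelian L.

Lemma lie_ad_mon (I : Type) (g : I -> L) s x c :
  commutant L c -> x ∘ ad_mon g s c = ad_mon g s (x ∘ c).
Proof.
move=> Cc; elim: s => //= i s IH.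
by rewrite adjoint_comm ?IH //; exact: ad_mon_commutant.
Qed.

Lemma ad_mon_comm (I J : Type) (g : I -> L) (h : J -> L) s t c :
  commutant L c -> ad_mon g s (ad_mon h t c) = ad_mon h t (ad_mon g s c).
Proof.
by move=> Cc; elim: s => //= i s ->; rewrite lie_ad_mon //; exact: ad_mon_commutant.
Qed.

Lemma ad_mon_perm (I : eqType) (g : I -> L) s t c :
  commutant L c -> perm_eq s t -> ad_mon g s c = ad_mon g t c.
Proof.
move=> Cc st; move: st (erefl (ad_mon g s c)).
apply: (catCA_perm_ind (P := fun t => ad_mon g s c = ad_mon g t c)) => s1 s2 s3 ->.
by rewrite !ad_mon_cat ad_mon_comm //; exact: ad_mon_commutant.
Qed.

Lemma ad_mon_sort (I : eqType) (le : rel I) (g : I -> L) s c :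
  commutant L c -> ad_mon g (sort le s) c = ad_mon g s c.
Proof. by move=> Cc; apply: ad_mon_perm; rewrite ?perm_sort. Qed.

End Monomials.

(** * Derivations of a metabelian product *)

(** Modules over the product algebra of [A] and [B] on which brackets act by
    zero: these are the ones whose semidirect product is again metabelian. *)
Record comm_action (k : fieldType) (A B : lieAlgType k) (M : lmodType k) :=
  CommAction {
    actm : A -> B -> M -> M;
    actm_lin : forall a b, linear (actm a b);
    actm_linl : forall r a a' b b' m,
      actm (r *: a + a') (r *: b + b') m = r *: actm a b m + actm a' b' m;
    actmC : forall a b a' b' m,
      actm a b (actm a' b' m) = actm a' b' (actm a b m);
    actm_mul : forall a a' b b' m, actm (a ∘ a') (b ∘ b') m = 0
  }.

Lemma cyclic_sum (M : zmodType) (x y z : M) : x - y + (z - x) + (y - z) = 0.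
Proof. by rewrite [X in X + _]addrC !subrKA subrr. Qed.

Section Semidirect.
Variables (k : fieldType) (A B : lieAlgType k) (M : lmodType k).

(** The argument [rho] is a phantom: the bracket, unlike the carrier, depends
    on it. *)
Definition semidirect_type (rho : comm_action A B M) : Type := (A * B * M)%type.

HB.instance Definition _ rho := GRing.Lmodule.on (semidirect_type rho).

Variable rho : comm_action A B M.
Local Notation semidirect := (semidirect_type rho).

Definition sd_mul (p q : semidirect) : semidirect :=
  (p.1.1 ∘ q.1.1, p.1.2 ∘ q.1.2,
   actm rho p.1.1 p.1.2 q.2 - actm rho q.1.1 q.1.2 p.2).

Lemma sd_linl (a : k) (x y z : semidirect) :
  sd_mul (a *: x + y) z = a *: sd_mul x z + sd_mul y z.
Proof.
rewrite /sd_mul; congr ((_, _), _) => /=; first exact: lie_linearl.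
  exact: lie_linearl.
rewrite actm_linl actm_lin scalerBr opprD addrACA; congr (_ + _).
Qed.

Lemma sd_mulxx (x : semidirect) : sd_mul x x = 0.
Proof. by rewrite /sd_mul !lie_mulxx subrr. Qed.

Lemma sd_linr (a : k) (x y z : semidirect) :
  sd_mul x (a *: y + z) = a *: sd_mul x y + sd_mul x z.
Proof.
rewrite /sd_mul; congr ((_, _), _) => /=; first exact: lie_linearr.
  exact: lie_linearr.
rewrite actm_linl actm_lin scalerBr opprD addrACA; congr (_ + _).
Qed.

Lemma sd_jacobi (x y z : semidirect) :
  sd_mul x (sd_mul y z) + sd_mul y (sd_mul z x) + sd_mul z (sd_mul x y) = 0.
Proof.
rewrite /sd_mul; congr ((_, _), _) => /=; [exact: lie_jacobi|exact: lie_jacobi|].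
rewrite !actm_mul !subr0 !(linB (actm_lin rho _ _)).
rewrite (actmC rho y.1.1 _ x.1.1) (actmC rho z.1.1 _ x.1.1).
rewrite (actmC rho z.1.1 _ y.1.1).
exact: cyclic_sum.
Qed.

HB.instance Definition _ := Lmodule_isLieAlgebra.Build k semidirect
  sd_linl sd_linr sd_mulxx sd_jacobi.

Lemma semidirect_metabelian :
  metabelian A -> metabelian B -> metabelian (semidirect : lieAlgType k).
Proof.
move=> mA mB [[a1 b1] m1] [[a2 b2] m2] [[a3 b3] m3] [[a4 b4] m4].
by congr ((_, _), _) => /=; rewrite ?mA ?mB // !actm_mul subrr.
Qed.

End Semidirect.

Section Product.
Variables (k : fieldType) (A B P : lieAlgType k) (iA : A -> P) (iB : B -> P).
Hypotheses (mA : metabelian A) (mB : metabelian B).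
Hypothesis hP : is_metabelian_product iA iB.

Lemma prod_meta : metabelian P. Proof. by case: hP. Qed.
Lemma prod_lift (C : lieAlgType k) (f : A -> C) (g : B -> C) :
  metabelian C -> lie_hom f -> lie_hom g ->
  exists h : P -> C, [/\ lie_hom h, forall a, h (iA a) = f a
                       & forall b, h (iB b) = g b].
Proof.
move=> mC hf hg; case: hP => _ _ _ /(_ C f g mC hf hg)[h [[hh <- <-] _]].
by exists h.
Qed.

Lemma prod_lift_eq (C : lieAlgType k) (h h' : P -> C) :
  metabelian C -> lie_hom h -> lie_hom h' ->
  (forall a, h (iA a) = h' (iA a)) -> (forall b, h (iB b) = h' (iB b)) -> h =1 h'.
Proof.
move=> mC hh hh' eA eB x.
have hom_comp (D : lieAlgType k) (i : D -> P) : lie_hom i -> lie_hom (h \o i).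
  move=> [iL iM]; have [hL hM] := hh; split=> [a y z|y z] /=.
    by rewrite iL hL.
  by rewrite iM hM.
case: hP => _ /hom_comp hfA /hom_comp hfB /(_ C _ _ mC hfA hfB)[g [_ g_uniq]].
rewrite -(g_uniq h) // -(g_uniq h') //; split=> //; apply/funext => y /=.
  by rewrite eA.
by rewrite eB.
Qed.

(** The map from [P] to the term model and back fixes both factors, hence is the
    identity; so every element of [P] is the value of a term. *)
Lemma prod_gen (S : set P) : submod S -> (forall a, S (iA a)) ->
  (forall b, S (iB b)) -> (forall x y, S x -> S y -> S (x ∘ y)) -> forall x, S x.
Proof.
move=> sS SA SB SM x.
have [mP hA hB _] := hP.
have [mQ jA jB _] := mprod_is_metabelian_product A B.
have [h [hh hiA hiB]] := prod_lift mQ jA jB.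
have hl := mp_lift_hom mP hA hB.
have <- : mp_lift iA iB (h x) = x.
  apply: (@prod_lift_eq P (fun y => mp_lift iA iB (h y)) id) => //.
  - split=> [a y z|y z]; first by rewrite hh.1 hl.1.
    by rewrite hh.2 hl.2.
  - by move=> a; rewrite hiA (mp_liftE mP hA hB).
  - by move=> b; rewrite hiB (mp_liftE mP hA hB).
elim/mprodW: (h x) => t; rewrite (mp_liftE mP hA hB).
elim: t => //= [|s Ss t St|a s Ss|s Ss t St].
- exact: sS.1.
- exact: submodD.
- exact: submodZ.
- exact: SM.
Qed.

Lemma hom_id (C : lieAlgType k) : lie_hom (fun x : C => x).
Proof. by []. Qed.

Lemma hom_zero (C D : lieAlgType k) : lie_hom (fun _ : C => 0 : D).
Proof. by split=> [a x y|x y]; rewrite ?scaler0 ?addr0 ?lie0l. Qed.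

Lemma prA_ex : exists h : P -> A,
  [/\ lie_hom h, forall a, h (iA a) = a & forall b, h (iB b) = 0].
Proof. exact: prod_lift mA (hom_id A) (hom_zero B A). Qed.

Lemma prB_ex : exists h : P -> B,
  [/\ lie_hom h, forall a, h (iA a) = 0 & forall b, h (iB b) = b].
Proof. exact: prod_lift mB (hom_zero A B) (hom_id B). Qed.

Definition prA : P -> A := sval (cid prA_ex).
Definition prB : P -> B := sval (cid prB_ex).

Lemma prA_hom : lie_hom prA. Proof. by rewrite /prA; case: cid => h []. Qed.
Lemma prB_hom : lie_hom prB. Proof. by rewrite /prB; case: cid => h []. Qed.
Lemma prA_iA a : prA (iA a) = a.
Proof. by rewrite /prA; case: cid => h []. Qed.
Lemma prA_iB b : prA (iB b) = 0.
Proof. by rewrite /prA; case: cid => h [? ? H]; exact: H. Qed.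
Lemma prB_iA a : prB (iA a) = 0.
Proof. by rewrite /prB; case: cid => h []. Qed.
Lemma prB_iB b : prB (iB b) = b.
Proof. by rewrite /prB; case: cid => h [? ? H]; exact: H. Qed.

(** A derivation is the last component of a homomorphism into a semidirect
    product, so the universal property glues derivations of the two factors. *)
Lemma prod_derivation (M : lmodType k) (rho : comm_action A B M)
    (dA : A -> M) (dB : B -> M) :
  linear dA -> linear dB ->
  (forall a a', dA (a ∘ a') = actm rho a 0 (dA a') - actm rho a' 0 (dA a)) ->
  (forall b b', dB (b ∘ b') = actm rho 0 b (dB b') - actm rho 0 b' (dB b)) ->
  exists d : P -> M, [/\ linear d, forall a, d (iA a) = dA a,
    forall b, d (iB b) = dB b &
    forall x y, d (x ∘ y) = actm rho (prA x) (prB x) (d y)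
                            - actm rho (prA y) (prB y) (d x)].
Proof.
move=> dAl dBl dAM dBM.
pose C : lieAlgType k := semidirect_type rho.
pose f a : C := (a, 0, dA a); pose g b : C := (0, b, dB b).
have hf : lie_hom f.
  split=> [r a a'|a a']; congr ((_, _), _);
    by rewrite /= ?scaler0 ?addr0 ?lie0l ?dAl ?dAM.
have hg : lie_hom g.
  split=> [r b b'|b b']; congr ((_, _), _);
    by rewrite /= ?scaler0 ?addr0 ?lie0l ?dBl ?dBM.
have [h [hh hA hB]] := prod_lift (@semidirect_metabelian _ _ _ _ rho mA mB) hf hg.
have prAE x : (h x).1.1 = prA x.
  apply: (@prod_lift_eq A (fun x => (h x).1.1)) => //.
  - by split=> [r y z|y z]; rewrite (hh.1, hh.2).
  - exact: prA_hom.
  - by move=> a; rewrite hA prA_iA.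
  - by move=> b; rewrite hB prA_iB.
have prBE x : (h x).1.2 = prB x.
  apply: (@prod_lift_eq B (fun x => (h x).1.2)) => //.
  - by split=> [r y z|y z]; rewrite (hh.1, hh.2).
  - exact: prB_hom.
  - by move=> a; rewrite hA prB_iA.
  - by move=> b; rewrite hB prB_iB.
exists (fun x => (h x).2); split=> [a x y|a|b|x y].
- by rewrite hh.1.
- by rewrite hA.
- by rewrite hB.
- by rewrite hh.2 /= !prAE !prBE.
Qed.

End Product.

(** * Modules over the symmetric algebra and power series *)

(** Modules over the symmetric algebra of [A] modulo its commutant. *)
Record comm_rep (k : fieldType) (A : lieAlgType k) (N : lmodType k) := CommRep {
  rep :> A -> N -> N;
  rep_linr : forall a, linear (rep a);
  rep_linl : forall f, linear (rep^~ f);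
  repC : forall a a' f, rep a (rep a' f) = rep a' (rep a f);
  rep_ker : forall c f, commutant A c -> rep c f = 0
}.

Section OperatorRep.
Variables (k : fieldType) (A : lieAlgType k) (I : eqType) (e : I -> A).
Hypothesis eB : basis_mod (commutant A) e.
Variables (N : lmodType k) (op : I -> N -> N).
Hypothesis op_lin : forall i, linear (op i).
Hypothesis opC : forall i j f, op i (op j f) = op j (op i f).

Let sC := commutant_submod A.

Definition op_act (a : A) (f : N) : N := lext sC eB (op^~ f) a.

Lemma op_act_linl f : linear (op_act^~ f).
Proof. exact: lext_lin. Qed.

Lemma op_actE i f : op_act (e i) f = op i f.
Proof. exact: lextE. Qed.

Lemma op_act_ker c f : commutant A c -> op_act c f = 0.
Proof. exact: lext_ker. Qed.

Lemma op_act_linr a : linear (op_act a).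
Proof.
move=> r f g; move: a; apply: (lin_ext_eq eB); first exact: op_act_linl.
- move=> s x y; rewrite !op_act_linl scalerDr !scalerA addrACA scalerDr.
  by rewrite !scalerA mulrC.
- by move=> x Cx; rewrite !op_act_ker // scaler0 addr0.
- by move=> i; rewrite !op_actE op_lin.
Qed.

Lemma op_actC a a' f : op_act a (op_act a' f) = op_act a' (op_act a f).
Proof.
move: a; apply: (lin_ext_eq eB).
- exact: op_act_linl.
- exact: lin_comp (op_act_linr a') (op_act_linl f).
- by move=> x Cx; rewrite /= !(op_act_ker _ Cx) (lin0 (op_act_linr a')).
move=> i; rewrite !op_actE; move: a'; apply: (lin_ext_eq eB).
- exact: lin_comp (op_lin i) (op_act_linl f).
- exact: op_act_linl.
- by move=> x Cx; rewrite /= !(op_act_ker _ Cx) (lin0 (op_lin i)).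
- by move=> j; rewrite !op_actE opC.
Qed.

(** The symmetric algebra is a polynomial ring in the basis vectors, so any
    commuting operators [op i] give it an action. *)
Definition op_rep : comm_rep A N :=
  CommRep op_act_linr op_act_linl op_actC op_act_ker.

End OperatorRep.

Section Shift.
Variables (k : fieldType) (J : eqType) (N : lmodType k).
Implicit Types (f : seq J -> N) (n s : seq J).

(** Multiplication by the variable [j] on power series, a sequence standing for
    the product of its entries. Power series spare the finiteness condition of
    polynomials, and the variables still act injectively on them. *)
Definition shift (j : J) f : seq J -> N :=
  fun n => if j \in n then f (rem j n) else 0.

Lemma shift_lin j : linear (shift j).
Proof.
move=> a f g; apply/funext => n; rewrite /shift /=.
rewrite !fctE; case: ifP => // _; by rewrite scaler0 addr0.
Qed.

Lemma mem_rem_neq (i j : J) n : i != j -> (i \in rem j n) = (i \in n).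
Proof.
move=> ij; have [jn|jn] := boolP (j \in n); last by rewrite rem_id.
by rewrite (perm_mem (perm_to_rem jn) i) inE (negbTE ij).
Qed.

Lemma remC (i j : J) n : rem i (rem j n) = rem j (rem i n).
Proof.
have [->//|ij] := eqVneq i j.
elim: n => //= x n IH; have [->|xj] := eqVneq x j.
  by rewrite eq_sym (negbTE ij) /= eqxx.
have [->|xi] := eqVneq x i; first by rewrite /= eqxx.
by rewrite /= (negbTE xj) (negbTE xi) IH.
Qed.

Lemma shiftC i j f : shift i (shift j f) = shift j (shift i f).
Proof.
apply/funext => n; rewrite /shift; have [->//|ij] := eqVneq i j.
rewrite (mem_rem_neq _ ij) (mem_rem_neq _ (_ : j != i)) 1?eq_sym // remC.
by case: (i \in n); case: (j \in n).
Qed.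

Lemma shift_cons j f n : shift j f (j :: n) = f n.
Proof. by rewrite /shift mem_head /= eqxx. Qed.

Definition const_series (x : N) : seq J -> N := fun n => if n is [::] then x else 0.

Lemma const_series_lin : linear const_series.
Proof.
move=> a x y; apply/funext => -[|j n] //=.
by rewrite !fctE /= scaler0 addr0.
Qed.

(** A monomial times a constant is supported on the rearrangements of that
    monomial; coefficients will be read off in this way. *)
Lemma foldr_shift s x n :
  foldr shift (const_series x) s n = if perm_eq s n then x else 0.
Proof.
elim: s n => [|j s IH] n /=.
  by case: n => [|j n] //=; rewrite perm_sym; case: perm_nilP.
rewrite /shift; case: ifP => [jn|jn].
  by rewrite IH (permPr (perm_to_rem jn)) perm_cons.
case: ifP => // /perm_mem /(_ j); by rewrite mem_head jn.
Qed.

End Shift.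

(** [A] acts on the coefficients and [B] by its variables. *)
Section SeriesAction.
Variables (k : fieldType) (A B : lieAlgType k) (N : lmodType k).
Variable rho : comm_rep A N.
Variables (J : eqType) (e : J -> B).
Hypothesis eB : basis_mod (commutant B) e.

Definition shift_rep : comm_rep B (seq J -> N) :=
  op_rep eB (@shift_lin k J N) (@shiftC k J N).

Lemma shift_repE j f : shift_rep (e j) f = shift j f.
Proof. exact: op_actE. Qed.

Definition series_act (a : A) (b : B) (f : seq J -> N) : seq J -> N :=
  (fun n => rho a (f n)) + shift_rep b f.

Lemma shift_rep_pointwise a b f :
  shift_rep b (fun n => rho a (f n)) = (fun n => rho a (shift_rep b f n)).
Proof.
move: b; apply: (lin_ext_eq eB).
- exact: rep_linl.
- move=> r x y; apply/funext => n; rewrite rep_linl.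
  by rewrite !fctE rep_linr.
- move=> x Cx; rewrite !rep_ker //; apply/funext => n.
  by rewrite (lin0 (rep_linr rho a)).
- move=> j; rewrite !shift_repE; apply/funext => n; rewrite /shift.
  by case: ifP => // _; rewrite (lin0 (rep_linr rho a)).
Qed.

Lemma series_act_lin a b : linear (series_act a b).
Proof.
move=> r f g; apply/funext => n; rewrite /series_act rep_linr.
by rewrite !fctE rep_linr scalerDr addrACA.
Qed.

Lemma series_act_linl r a a' b b' f :
  series_act (r *: a + a') (r *: b + b') f
  = r *: series_act a b f + series_act a' b' f.
Proof.
apply/funext => n; rewrite /series_act rep_linl.
by rewrite !fctE rep_linl scalerDr addrACA.
Qed.

Lemma series_actC a b a' b' f :
  series_act a b (series_act a' b' f) = series_act a' b' (series_act a b f).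
Proof.
apply/funext => n; rewrite /series_act !(linD (rep_linr shift_rep _)).
rewrite !shift_rep_pointwise !fctE !(linD (rep_linr rho _)) (repC shift_rep b).
by rewrite (repC rho a) -!addrA; congr (_ + _); rewrite addrCA.
Qed.

Lemma series_act_mul a a' b b' f : series_act (a ∘ a') (b ∘ b') f = 0.
Proof.
apply/funext => n; rewrite /series_act !fctE !rep_ker ?addr0 //; exact: commutantM.
Qed.

Definition series_action : comm_action A B (seq J -> N) :=
  CommAction series_act_lin series_act_linl series_actC series_act_mul.

End SeriesAction.

(** * The Magnus embedding *)

Section MagnusModule.
Variables (k : fieldType) (A : lieAlgType k).
Hypothesis mA : metabelian A.
Variables (I : eqType) (e : I -> A).
Hypothesis eB : basis_mod (commutant A) e.
Variable le : rel I.
Hypothesis lo : linear_order le.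

Let sC := commutant_submod A.

(** The variable [i] of the coinduced module, functions of a monomial with
    values in [A]: it acts by multiplying the argument. Arguments are sorted
    after each multiplication so that the operators commute on all functions. *)
Definition coind_op (i : I) (f : seq I -> A) : seq I -> A :=
  fun m => f (sort le (i :: m)).

Lemma coind_op_lin i : linear (coind_op i).
Proof. by move=> a f g; apply/funext. Qed.

Lemma coind_opC i j f : coind_op i (coind_op j f) = coind_op j (coind_op i f).
Proof.
apply/funext => m; rewrite /coind_op; congr (f _).
rewrite !sort_cons_sort //; apply/(sort_eqP lo)/permPl.
exact: (perm_catCA [:: j] [:: i] m).
Qed.

Definition coind_rep : comm_rep A (seq I -> A) :=
  op_rep eB coind_op_lin coind_opC.

Definition coind_ev (c : A) : seq I -> A := fun m => ad_mon e m c.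

(** The value at [e j] of the derivation to be built. The bracket of [e i] and
    [e j] must be sent to [e i . f j - e j . f i]; a solution is to bracket
    [e j] with the least variable [l] of the monomial, provided that [l]
    precedes [j]. *)
Definition coind_cocycle (j : I) : seq I -> A := fun m =>
  if sort le m is l :: t then (if le l j then ad_mon e t (e l ∘ e j) else 0) else 0.

(** The first summand prescribes the values on the basis; the second one is the
    inclusion of the commutant, applied to the component of [a] there. *)
Definition magnus_der (a : A) : seq I -> A :=
  lext sC eB coind_cocycle a + coind_ev (a - lext sC eB e a).

Lemma coind_ev_lin : linear coind_ev.
Proof. by move=> a x y; apply/funext => m; rewrite /coind_ev ad_mon_lin. Qed.

Lemma magnus_der_lin : linear magnus_der.
Proof.
move=> a x y; rewrite /magnus_der !lext_lin opprD addrACA -scalerBr.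
by rewrite coind_ev_lin scalerDr addrACA.
Qed.

Lemma magnus_derC c : commutant A c -> magnus_der c = coind_ev c.
Proof. by move=> Cc; rewrite /magnus_der !lext_ker // add0r subr0. Qed.

Lemma magnus_derE j : magnus_der (e j) = coind_cocycle j.
Proof.
by rewrite /magnus_der !lextE subrr (lin0 coind_ev_lin) addr0.
Qed.

Lemma coind_rep_ev a c : commutant A c -> coind_rep a (coind_ev c) = coind_ev (a ∘ c).
Proof.
move=> Cc; move: a; apply: (lin_ext_eq eB).
- exact: rep_linl.
- exact: lin_comp coind_ev_lin (lie_linl c).
- move=> x Cx; rewrite rep_ker // commutant_abelian //.
  by rewrite (lin0 coind_ev_lin).
- move=> i; rewrite [LHS]op_actE; apply/funext => m; rewrite /coind_op /coind_ev.
  by rewrite ad_mon_sort //= lie_ad_mon.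
Qed.

(** At a monomial [m] with least variable [l] not after [i], this is the Jacobi
    identity for [e l], [e i], [e j], the other variables acting on it; if [l]
    comes after [i], then [i] becomes the least variable and only the first term
    survives, with the value required. *)
Lemma coind_cocycleE i j :
  coind_ev (e i ∘ e j) = coind_op i (coind_cocycle j) - coind_op j (coind_cocycle i).
Proof.
have [le_tot le_tr le_anti] := lo.
wlog ij : i j / le i j.
  move=> H; have [/H//|/H/(congr1 (fun f => - f)) E] := orP (le_tot i j).
  by rewrite lieC (linN coind_ev_lin) E opprB.
have [<-{j ij}|neij] := eqVneq i j.
  by rewrite lie_mulxx subrr (lin0 coind_ev_lin).
have nji : le j i = false.
  by apply/negP => ji; case/eqP: neij; apply: le_anti; rewrite ij ji.
have Cij u v : commutant A (e u ∘ e v) := commutantM _ _.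
apply/funext => m; rewrite !fctE /coind_ev /coind_op /coind_cocycle.
rewrite -(ad_mon_sort mA le e m) // !(sort_id lo (sort_is_sorted lo _)).
rewrite -(sort_cons_sort lo i m) -(sort_cons_sort lo j m).
(* [m] has been replaced by its sorted form, with least variable [l]. *)
have := sort_is_sorted lo m; case: (sort le m) => [_|l t].
  by rewrite !sort_cons // ij nji subr0.
rewrite [sorted _ _]/= path_sortedE // => /andP[lt _].
have [li|il] := boolP (le l i).
  have lj : le l j := le_tr _ _ _ li ij.
  rewrite !sort_insert // lj !ad_mon_sort //= li !lie_ad_mon // -(linB (ad_mon_lin e t)).
  by rewrite lie_leibniz (lieC (e l ∘ e i)) addrC.
have it : all (le i) (l :: t).
  have il' := not_le lo il.
  by rewrite /= il'; exact: (all_le_trans lo il' lt).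
rewrite (sort_cons lo it) ij ad_mon_sort //; have [jl|jl] := boolP (le j l).
  rewrite sort_cons ?nji ?subr0 //=.
  by rewrite jl; exact: (all_le_trans lo jl).
by rewrite (sort_insert lo lt (not_le lo jl)) (negbTE il) subr0.
Qed.

Lemma magnus_derM a a' :
  magnus_der (a ∘ a') = coind_rep a (magnus_der a') - coind_rep a' (magnus_der a).
Proof.
have linRHS (V W : lmodType k) (f g : V -> W) :
    linear f -> linear g -> linear (fun x => f x - g x).
  by move=> fL gL r x y; rewrite fL gL opprD addrACA -scalerBr.
have dC x y : commutant A x ->
    magnus_der (x ∘ y) = coind_rep x (magnus_der y) - coind_rep y (magnus_der x).
  move=> Cx; rewrite [coind_rep x _]rep_ker // (magnus_derC Cx) sub0r.
  rewrite coind_rep_ev // lieC (linN magnus_der_lin) magnus_derC //.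
  exact: commutantM.
move: a; apply: (lin_ext_eq eB).
- exact: lin_comp magnus_der_lin (lie_linl a').
- apply: linRHS; first exact: rep_linl.
  exact: lin_comp (rep_linr _ _) magnus_der_lin.
- by move=> x; exact: dC.
move=> i; move: a'; apply: (lin_ext_eq eB).
- exact: lin_comp magnus_der_lin (lie_linr _).
- apply: linRHS; last exact: rep_linl.
  exact: lin_comp (rep_linr _ _) magnus_der_lin.
- move=> x Cx; rewrite lieC (linN magnus_der_lin) dC // opprB //.
- move=> j; rewrite !magnus_derE magnus_derC; last exact: commutantM.
  by rewrite ![coind_rep _ _]op_actE coind_cocycleE.
Qed.

Lemma magnus_der_inj c : commutant A c -> magnus_der c = 0 -> c = 0.
Proof.
by move=> Cc; rewrite magnus_derC // => /(congr1 (fun f => f [::])).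
Qed.

End MagnusModule.

(** The class of the extension of [A] modulo its commutant by the commutant dies
    in a coinduced module, which is why the inclusion of the commutant extends
    to a derivation of the whole of [A]. *)
Lemma magnus_embedding (k : fieldType) (A : lieAlgType k) : metabelian A ->
  exists (N : lmodType k) (rho : comm_rep A N) (d : A -> N),
  [/\ linear d, forall a a', d (a ∘ a') = rho a (d a') - rho a' (d a)
    & forall c, commutant A c -> d c = 0 -> c = 0].
Proof.
move=> mA; have [I [e [eB _]]] := basis_mod_ex (commutant_submod A) 0.
have [le lo] := linear_order_ex I.
exists (seq I -> A), (coind_rep eB lo), (magnus_der eB le).
split; [exact: magnus_der_lin|exact: magnus_derM|].
exact: magnus_der_inj.
Qed.

(** * Normal form of the commutant of a product *)

Section FiniteSpan.
Variables (k : fieldType) (C P : lmodType k) (K : set C).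
Hypothesis sK : submod K.
Variables (J : eqType) (Q : pred J) (E : J -> C -> P).
Hypothesis E_lin : forall j, linear (E j).

(** [Q] selects the indices in normal form, and [K] the admissible coefficients. *)
Definition fspan : set P := fun y => exists (s : seq J) (c : J -> C),
  [/\ uniq s, all Q s, forall j, j \notin s -> c j = 0, forall j, K (c j)
    & y = \sum_(j <- s) E j (c j)].

Lemma fspan_submod : submod fspan.
Proof.
split=> [|a _ _ [s [c [us Qs c0 Kc ->]]] [t [d [ut Qt d0 Kd ->]]]].
  by exists [::], (fun=> 0); split=> // [_|]; [exact: sK.1 | rewrite big_nil].
have uu := undup_uniq (s ++ t).
exists (undup (s ++ t)), (fun j => a *: c j + d j); split=> //.
- by apply/allP => j; rewrite mem_undup mem_cat => /orP[/(allP Qs)|/(allP Qt)].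
- move=> j; rewrite mem_undup mem_cat negb_or => /andP[/c0 -> /d0 ->].
  by rewrite scaler0 addr0.
- by move=> j; apply: sK.2.
rewrite (big_support us uu) ?(big_support ut uu); first last.
- by move=> j /c0 ->; rewrite (lin0 (E_lin j)).
- by move=> j; rewrite mem_undup mem_cat => ->.
- by move=> j /d0 ->; rewrite (lin0 (E_lin j)).
- by move=> j; rewrite mem_undup mem_cat orbC => ->.
rewrite scaler_sumr -big_split /=; apply: eq_bigr => j _.
by rewrite E_lin.
Qed.

Lemma fspan_in j c : Q j -> K c -> fspan (E j c).
Proof.
move=> Qj Kc; exists [:: j], (fun i => if i == j then c else 0).
split; rewrite ?big_seq1 ?eqxx //= ?Qj // => i; first by rewrite inE => /negbTE ->.
by case: ifP => // _; exact: sK.1.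
Qed.

Lemma fspan_min (S : set P) : submod S -> (forall j c, Q j -> K c -> S (E j c)) ->
  forall y, fspan y -> S y.
Proof.
move=> sS SE _ [s [c [_ Qs _ Kc ->]]]; apply: submod_sum => // j js.
by apply: SE => //; exact: (allP Qs).
Qed.

End FiniteSpan.

Section FactorIdeal.
Variables (k : fieldType) (A B P : lieAlgType k) (iA : A -> P) (iB : B -> P).
Hypotheses (mP : metabelian P) (hA : lie_hom iA) (hB : lie_hom iB).
Variables (J : eqType) (e : J -> B).
Hypothesis eB : basis_mod (commutant B) e.
Variable le : rel J.

(** The ideal of [P] generated by the image of [commutant A]: that commutant is
    stable under [A], so monomials in [B] suffice. *)
Definition factor_ideal : set P :=
  fspan (commutant A) (sorted le) (fun n c => ad_mon (iB \o e) n (iA c)).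

Lemma factor_ideal_submod : submod factor_ideal.
Proof.
apply: fspan_submod; first exact: commutant_submod.
by move=> n; exact: lin_comp (ad_mon_lin _ _) hA.1.
Qed.

Hypothesis lo : linear_order le.

Lemma factor_ideal_in n c : commutant A c -> factor_ideal (ad_mon (iB \o e) n (iA c)).
Proof.
move=> Cc; rewrite -(ad_mon_sort mP le) //; last exact: hom_commutant.
apply: (fspan_in (commutant_submod A)
  (fun n c => ad_mon (iB \o e) n (iA c))) => //.
exact: sort_is_sorted.
Qed.

Lemma factor_ideal_commutant y : factor_ideal y -> commutant P y.
Proof.
apply: fspan_min; first exact: commutant_submod.
by move=> n c _ Cc; apply: ad_mon_commutant; exact: hom_commutant.
Qed.

Lemma factor_ideal_closedA a y : factor_ideal y -> factor_ideal (iA a ∘ y).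
Proof.
move: y; apply: fspan_min; first exact: submod_preim (lie_linr _) factor_ideal_submod.
move=> n c _ Cc; rewrite lie_ad_mon //; last exact: hom_commutant.
by rewrite -hA.2; apply: factor_ideal_in; exact: commutantM.
Qed.

Lemma factor_ideal_closedB b y : factor_ideal y -> factor_ideal (iB b ∘ y).
Proof.
move=> ty; move: b; apply: eB.2.
- exact: submod_preim (lin_comp (lie_linl y) hB.1) factor_ideal_submod.
- move=> b Cb; rewrite commutant_abelian //; first exact: factor_ideal_submod.1.
    exact: hom_commutant.
  exact: factor_ideal_commutant.
move=> j; move: y ty; apply: fspan_min.
  exact: submod_preim (lie_linr _) factor_ideal_submod.
by move=> n c _; exact: (factor_ideal_in (j :: n)).
Qed.

End FactorIdeal.

Section Cross.
Variables (k : fieldType) (A B P : lieAlgType k) (iA : A -> P) (iB : B -> P).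
Hypotheses (mP : metabelian P) (hA : lie_hom iA) (hB : lie_hom iB).
Variables (I J : eqType) (eA : I -> A) (eB : J -> B).
Variables (leI : rel I) (leJ : rel J).
Hypotheses (loI : linear_order leI) (loJ : linear_order leJ).

Local Notation gA := (iA \o eA).
Local Notation gB := (iB \o eB).

(** The counterpart of the monomial with variables [m] and [n] in the commutant
    of [P]; modulo the ideals generated by the two commutants, it does not matter
    which variable of [m] and which of [n] are bracketed. The first ones, hence
    the least ones for sorted sequences, are the choice made here. *)
Definition cross (m : seq I) (n : seq J) : P :=
  match m, n with
  | i :: m', j :: n' => ad_mon gA m' (ad_mon gB n' (gA i ∘ gB j))
  | _, _ => 0
  end.

Lemma cross_commutant m n : commutant P (cross m n).
Proof.
case: m n => [|i m] [|j n]; try exact: (commutant_submod P).1.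
by do 2![apply: ad_mon_commutant]; exact: commutantM.
Qed.

(** If [l] precedes the first variable [i] of [m], the Jacobi identity exchanges
    [l] and [i]; the error term contains [eA l ∘ eA i], hence lies in the ideal
    generated by [commutant A]. *)
Lemma lie_cross l m n : m != [::] -> sorted leI m ->
  exists2 z, factor_ideal iA iB eB leJ z
    & gA l ∘ cross m n = cross (sort leI (l :: m)) n + z.
Proof.
have t0 := (factor_ideal_submod iB hA eB leJ).1.
case: m n => [|i m] [|j n] //= _ sm.
  by exists 0; rewrite // lie0r addr0; case: sort.
have CM x y : commutant P (x ∘ y) := commutantM x y.
have CmB s c : commutant P c -> commutant P (ad_mon gB s c) by exact: ad_mon_commutant.
have im : all (leI i) m.
  by move: sm; rewrite /= path_sortedE; case: loI => // _ tr _ /andP[].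
have [il|/(not_le loI) li] := boolP (leI i l).
  exists 0 => //; rewrite addr0 (sort_insert loI) //= (ad_mon_sort mP) //=; exact: CmB.
rewrite (sort_cons loI) /=; last by rewrite li (all_le_trans loI li im).
rewrite (ad_mon_sort mP) /=; last exact: CmB.
exists (- ad_mon gB (j :: n) (iA (ad_mon eA m (eA l ∘ eA i)))).
  apply: submodN; first exact: factor_ideal_submod.
  by apply: factor_ideal_in => //; apply: ad_mon_commutant; exact: commutantM.
have -> : iA (ad_mon eA m (eA l ∘ eA i)) = ad_mon gA m (gA l ∘ gA i).
  by rewrite /= -hA.2; elim: (m) => //= u s IH; rewrite hA.2 IH.
rewrite -(ad_mon_comm mP gA gB) // [ad_mon gB (j :: n) _]/=.
have lieB s x c : commutant P c -> x ∘ ad_mon gB s c = ad_mon gB s (x ∘ c).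
  exact: lie_ad_mon.
have lieA s x c : commutant P c -> x ∘ ad_mon gA s c = ad_mon gA s (x ∘ c).
  exact: lie_ad_mon.
rewrite !lieA ?lieB //; try exact: CmB.
rewrite -(linB (ad_mon_lin gA m)) -(linB (ad_mon_lin gB n)).
congr (ad_mon _ _ (ad_mon _ _ _)).
by rewrite lie_leibniz addrC [X in _ + X]lieC.
Qed.

End Cross.

Lemma cancel_diagonal (M : zmodType) (u v a b c d : M) :
  u + (v + ((a + b) + (c + d))) - (a + d) = b + c + v + u.
Proof.
rewrite (addrC c) (addrACA a) (addrCA v) (addrCA u) [LHS]addrC addKr.
by rewrite addrC (addrC v).
Qed.

Section NormalForm.
Variables (k : fieldType) (A B P : lieAlgType k) (iA : A -> P) (iB : B -> P).
Hypotheses (mA : metabelian A) (mB : metabelian B).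
Hypothesis hP : is_metabelian_product iA iB.
Variables (I J : eqType) (eA : I -> A) (eB : J -> B).
Hypotheses (bA : basis_mod (commutant A) eA) (bB : basis_mod (commutant B) eB).
Variables (leI : rel I) (leJ : rel J).
Hypotheses (loI : linear_order leI) (loJ : linear_order leJ).

Let mP : metabelian P := prod_meta hP.
Let hA : lie_hom iA. Proof. by case: hP. Qed.
Let hB : lie_hom iB. Proof. by case: hP. Qed.

Definition cross_index (p : seq I * seq J) : bool :=
  [&& p.1 != [::], sorted leI p.1, p.2 != [::] & sorted leJ p.2].

Definition cross_span : set P :=
  fspan (C := k^o) setT cross_index (fun p r => (r : k) *: cross iA iB eA eB p.1 p.2).

Lemma cross_lin (p : seq I * seq J) :
  linear (fun r : k^o => (r : k) *: cross iA iB eA eB p.1 p.2).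
Proof. by move=> a r s; rewrite scalerDl scalerA. Qed.

Lemma cross_span_submod : submod cross_span.
Proof. by apply: fspan_submod => //; exact: cross_lin. Qed.

Lemma cross_in m n : m != [::] -> sorted leI m -> n != [::] -> sorted leJ n ->
  cross_span (cross iA iB eA eB m n).
Proof.
move=> m0 sm n0 sn; rewrite -[cross _ _ _ _ _ _]scale1r.
apply: (fspan_in (C := k^o) _
  (fun p r => (r : k) *: cross iA iB eA eB p.1 p.2) (j := (m, n))) => //.
by rewrite /cross_index /= m0 sm n0 sn.
Qed.

Lemma cross_swap m n : cross iA iB eA eB m n = - cross iB iA eB eA n m.
Proof.
case: m n => [|i m] [|j n]; rewrite /= ?oppr0 // -(linN (ad_mon_lin _ n)).
rewrite -(linN (ad_mon_lin _ m)) -lieC ad_mon_comm //; exact: commutantM.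
Qed.

Definition normal_form (y : P) : Prop := exists y0 yA yB,
  [/\ cross_span y0, factor_ideal iA iB eB leJ yA, factor_ideal iB iA eA leI yB
    & y = y0 + yA + yB].

Let sA := factor_ideal_submod iB hA eB leJ.
Let sB := factor_ideal_submod iA hB eA leI.

Lemma normal_form_submod : submod normal_form.
Proof.
split=> [|a _ _ [x0 [xA [xB [x0P xAP xBP ->]]]] [y0 [yA [yB [y0P yAP yBP ->]]]]].
  exists 0, 0, 0; split; rewrite ?addr0 //; first exact: cross_span_submod.1.
    exact: sA.1.
  exact: sB.1.
exists (a *: x0 + y0), (a *: xA + yA), (a *: xB + yB); split.
- exact: cross_span_submod.2.
- exact: sA.2.
- exact: sB.2.
- by rewrite !scalerDr addrACA (addrACA (a *: x0)).
Qed.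

Lemma normal_form_cross y : cross_span y -> normal_form y.
Proof.
by move=> cy; exists y, 0, 0; split; rewrite ?addr0 //;
  [exact: sA.1|exact: sB.1].
Qed.

Lemma normal_form_idealA y : factor_ideal iA iB eB leJ y -> normal_form y.
Proof.
by move=> ty; exists 0, y, 0; split; rewrite ?addr0 ?add0r //;
  [exact: cross_span_submod.1|exact: sB.1].
Qed.

Lemma normal_form_idealB y : factor_ideal iB iA eA leI y -> normal_form y.
Proof.
by move=> ty; exists 0, 0, y; split; rewrite ?addr0 ?add0r //;
  [exact: cross_span_submod.1|exact: sA.1].
Qed.

Lemma normal_form_min (S : set P) : submod S ->
  (forall m n, m != [::] -> sorted leI m -> n != [::] -> sorted leJ n ->
     S (cross iA iB eA eB m n)) ->
  (forall y, factor_ideal iA iB eB leJ y -> S y) ->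
  (forall y, factor_ideal iB iA eA leI y -> S y) ->
  forall y, normal_form y -> S y.
Proof.
move=> sS Sc SA SB _ [y0 [yA [yB [cy0 /SA SyA /SB SyB ->]]]].
do 2![apply: submodD => //]; move: y0 cy0; apply: fspan_min => //.
move=> [m n] r /and4P[/= m0 sm n0 sn] _; apply: submodZ => //; exact: Sc.
Qed.

Lemma normal_form_commutant y : normal_form y -> commutant P y.
Proof.
apply: normal_form_min; first exact: commutant_submod.
- by move=> *; exact: cross_commutant.
- exact: factor_ideal_commutant.
- exact: factor_ideal_commutant.
Qed.

Lemma normal_form_closedA a y : normal_form y -> normal_form (iA a ∘ y).
Proof.
move: y; apply: normal_form_min.
- exact: submod_preim (lie_linr _) normal_form_submod.
- move=> m n m0 sm n0 sn; move: a; apply: bA.2.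
  + exact: submod_preim (lin_comp (lie_linl _) hA.1) normal_form_submod.
  + move=> c Cc; rewrite commutant_abelian //; first exact: normal_form_submod.1.
      exact: hom_commutant.
    exact: cross_commutant.
  + move=> l; have [z tz ->] := lie_cross iB mP hA eA eB loI loJ l n m0 sm.
    apply: submodD; first exact: normal_form_submod.
      apply: normal_form_cross; apply: cross_in => //.
        by rewrite -size_eq0 size_sort.
      exact: sort_is_sorted.
    exact: normal_form_idealA.
- move=> y ty; apply: normal_form_idealA; exact: factor_ideal_closedA.
- move=> y ty; apply: normal_form_idealB; exact: factor_ideal_closedB.
Qed.

Lemma normal_form_closedB b y : normal_form y -> normal_form (iB b ∘ y).
Proof.
move: y; apply: normal_form_min.
- exact: submod_preim (lie_linr _) normal_form_submod.
- move=> m n m0 sm n0 sn; move: b; apply: bB.2.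
  + exact: submod_preim (lin_comp (lie_linl _) hB.1) normal_form_submod.
  + move=> c Cc; rewrite commutant_abelian //; first exact: normal_form_submod.1.
      exact: hom_commutant.
    exact: cross_commutant.
  + move=> l; rewrite cross_swap lieNr; apply: submodN; first exact: normal_form_submod.
    have [z tz ->] := lie_cross iA mP hB eB eA loJ loI l m n0 sn.
    apply: submodD; first exact: normal_form_submod.
      rewrite -[cross _ _ _ _ _ _]opprK -cross_swap.
      apply: submodN; first exact: normal_form_submod.
      apply: normal_form_cross; apply: cross_in => //.
        by rewrite -size_eq0 size_sort.
      exact: sort_is_sorted.
    exact: normal_form_idealB.
- move=> y ty; apply: normal_form_idealA; exact: factor_ideal_closedB.
- move=> y ty; apply: normal_form_idealB; exact: factor_ideal_closedA.
Qed.

Lemma normal_form_bracket a b : normal_form (iA a ∘ iB b).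
Proof.
move: a; apply: bA.2.
- exact: submod_preim (lin_comp (lie_linl _) hA.1) normal_form_submod.
- move=> c Cc; rewrite lieC; apply: submodN; first exact: normal_form_submod.
  apply: normal_form_closedB; apply: normal_form_idealA.
  exact: (factor_ideal_in _ mP hA _ _ [::]).
move=> i; move: b; apply: bB.2.
- exact: submod_preim (lin_comp (lie_linr _) hB.1) normal_form_submod.
- move=> c Cc.
  apply: normal_form_closedA; apply: normal_form_idealB.
  exact: (factor_ideal_in _ mP hB _ _ [::]).
by move=> j; apply: normal_form_cross; exact: (@cross_in [:: i] [:: j]).
Qed.

(** Elements [iA a + iB b + y] with [y] in normal form are closed under brackets,
    because normal forms are closed under both factors and annihilate each
    other. *)
Lemma prod_decomposition x :
  normal_form (x - (iA (prA mA hP x) + iB (prB mB hP x))).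
Proof.
have sN := normal_form_submod.
have [pAl pAM] := prA_hom mA hP; have [pBl pBM] := prB_hom mB hP.
move: x; apply: (prod_gen hP).
- apply: (submod_preim (f := fun x => x - (iA (prA mA hP x) + iB (prB mB hP x)))) => //.
  move=> r x y; rewrite pAl pBl hA.1 hB.1 addrACA -scalerDr.
  by rewrite opprD addrACA -scalerBr.
- move=> a; rewrite prA_iA prB_iA (lin0 hB.1) addr0 subrr; exact: sN.1.
- move=> b; rewrite prA_iB prB_iB (lin0 hA.1) add0r subrr; exact: sN.1.
move=> x x'; rewrite pAM pBM.
move: (prA mA hP x) (prB mB hP x) (prA mA hP x') (prB mB hP x') => a b a' b'.
rewrite -{2}[x](subrK (iA a + iB b)) -{2}[x'](subrK (iA a' + iB b')).
move: (x - _) (x' - _) => {x x'}y y' ny ny'.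
have Cy := normal_form_commutant ny; have Cy' := normal_form_commutant ny'.
have [[HA HB] HAB] := (normal_form_closedA, normal_form_closedB, normal_form_bracket).
have -> : (y + (iA a + iB b)) ∘ (y' + (iA a' + iB b'))
    - (iA (a ∘ a') + iB (b ∘ b'))
  = iA a ∘ iB b' + iB b ∘ iA a' + (iA a + iB b) ∘ y' + y ∘ (iA a' + iB b').
  rewrite hA.2 hB.2 (lieDl y) !(lieDr _ y') (commutant_abelian mP Cy Cy') add0r.
  rewrite (lieDl _ _ (iA a' + iB b')) !(lieDr _ (iA a')).
  exact: cancel_diagonal.
apply: (submodD sN); [apply: (submodD sN); [apply: (submodD sN)|]|]; first by [].
- by rewrite lieC; exact: (submodN sN).
- by rewrite lieDl; apply: (submodD sN); auto.
- by rewrite lieC lieDl; apply/(submodN sN)/(submodD sN); auto.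
Qed.

(** An element of the commutant projects into the commutants of [A] and [B], so
    the components that [prod_decomposition] splits off are in normal form too. *)
Lemma commutant_normal_form y : commutant P y -> normal_form y.
Proof.
move=> Cy; have sN := normal_form_submod.
rewrite -[y](subrK (iA (prA mA hP y) + iB (prB mB hP y))).
apply: (submodD sN); first exact: prod_decomposition.
apply: (submodD sN).
- apply: normal_form_idealA; apply: (factor_ideal_in _ mP hA _ _ [::]) => //.
  by apply: hom_commutant Cy; exact: prA_hom.
- apply: normal_form_idealB; apply: (factor_ideal_in _ mP hB _ _ [::]) => //.
  by apply: hom_commutant Cy; exact: prB_hom.
Qed.

End NormalForm.

(** * Regular elements of a product *)

Section SeriesDerivation.
Variables (k : fieldType) (A B P : lieAlgType k) (iA : A -> P) (iB : B -> P).
Hypotheses (mA : metabelian A) (mB : metabelian B).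
Hypothesis hP : is_metabelian_product iA iB.
Variables (N : lmodType k) (rho : comm_rep A N) (d : A -> N).
Hypothesis d_lin : linear d.
Hypothesis d_mul : forall a a', d (a ∘ a') = rho a (d a') - rho a' (d a).
Variables (J : eqType) (eB : J -> B).
Hypothesis bB : basis_mod (commutant B) eB.

Let mP : metabelian P := prod_meta hP.
Let hA : lie_hom iA. Proof. by case: hP. Qed.
Let hB : lie_hom iB. Proof. by case: hP. Qed.
Local Notation act := (series_act rho bB).
Local Notation one := (@const_series k J N).

(** A derivation of [A] into [N] is extended by zero on [B]; what it kills or
    detects is read off from the power series in the variables of [B]. *)
Lemma series_derivation_ex : exists D : P -> seq J -> N, [/\ linear D,
  forall a, D (iA a) = one (d a), forall b, D (iB b) = 0 &
  forall x y, D (x ∘ y) = act (prA mA hP x) (prB mB hP x) (D y)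
                          - act (prA mA hP y) (prB mB hP y) (D x)].
Proof.
apply: (prod_derivation mA mB hP (rho := series_action rho bB)
  (dA := fun a => one (d a)) (dB := fun=> 0)).
- exact: lin_comp (@const_series_lin k J N) d_lin.
- by move=> r b b'; rewrite scaler0 addr0.
- have act0 a z : act a 0 (one z) = one (rho a z).
    apply/funext => n; rewrite /series_act (lin0 (rep_linl (shift_rep N bB) _)).
    rewrite !fctE addr0; case: n => //= j n; exact: lin0 (rep_linr _ _).
  move=> a a'; rewrite /= !act0 d_mul.
  exact: linB (@const_series_lin k J N) _ _.
- by move=> b b' /=; rewrite !(lin0 (series_act_lin rho bB _ _)) subrr.
Qed.

Definition series_der : P -> seq J -> N := sval (cid series_derivation_ex).
Local Notation D := series_der.

Lemma series_der_lin : linear D.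
Proof. by rewrite /series_der; case: cid => ? []. Qed.

Lemma series_der_iA a : D (iA a) = one (d a).
Proof. by rewrite /series_der; case: cid => ? []. Qed.

Lemma series_der_iB b : D (iB b) = 0.
Proof. by rewrite /series_der; case: cid => ? [? ? H ?]; exact: H. Qed.

Lemma series_der_mul x y :
  D (x ∘ y) = act (prA mA hP x) (prB mB hP x) (D y)
              - act (prA mA hP y) (prB mB hP y) (D x).
Proof. by rewrite /series_der; case: cid => ? []. Qed.

Lemma series_der_lie x y : commutant P y ->
  D (x ∘ y) = act (prA mA hP x) (prB mB hP x) (D y).
Proof.
move=> Cy; rewrite series_der_mul /series_act [X in _ - X](_ : _ = 0) ?subr0 //.
apply/funext => n; rewrite !fctE rep_ker ?add0r; last first.
  by apply: hom_commutant Cy; exact: prA_hom.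
rewrite rep_ker //; apply: hom_commutant Cy; exact: prB_hom.
Qed.

Lemma series_der_lieA a y : commutant P y ->
  D (iA a ∘ y) = fun n => rho a (D y n).
Proof.
move=> Cy; rewrite series_der_lie // prA_iA prB_iA /series_act.
by rewrite (lin0 (rep_linl (shift_rep N bB) _)) addr0.
Qed.

Lemma series_der_lieB j y : commutant P y -> D (iB (eB j) ∘ y) = shift j (D y).
Proof.
move=> Cy; rewrite series_der_lie // prA_iB prB_iB /series_act shift_repE.
apply/funext => n; rewrite !fctE.
by rewrite (lin0 (rep_linl rho _)) add0r.
Qed.

Lemma series_der_monB s y : commutant P y ->
  D (ad_mon (iB \o eB) s y) = foldr (@shift k J N) (D y) s.
Proof.
move=> Cy; elim: s => //= j s IH; rewrite series_der_lieB ?IH //.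
exact: ad_mon_commutant.
Qed.

Lemma series_der_monA (I : Type) (eA : I -> A) s y n : commutant P y ->
  D (ad_mon (iA \o eA) s y) n = foldr (fun i => rho (eA i)) (D y n) s.
Proof.
move=> Cy; elim: s => //= i s IH; rewrite series_der_lieA ?IH //.
exact: ad_mon_commutant.
Qed.

Lemma series_der_ideal s c n : commutant A c ->
  D (ad_mon (iB \o eB) s (iA c)) n = if perm_eq s n then d c else 0.
Proof.
move=> Cc; rewrite series_der_monB; last exact: hom_commutant.
by rewrite series_der_iA foldr_shift.
Qed.

Lemma series_der_other_ideal (I : eqType) (eA : I -> A) (leI : rel I) y :
  factor_ideal iB iA eA leI y -> D y = 0.
Proof.
move: y; apply: fspan_min; first exact: submod_ker series_der_lin.
move=> m c _ Cc; apply/funext => n; rewrite series_der_monA; last exact: hom_commutant.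
rewrite series_der_iB; elim: m => //= i m ->.
by rewrite (lin0 (rep_linr rho _)).
Qed.

Lemma series_der_cross (I : Type) (eA : I -> A) i m j n n' :
  D (ad_mon (iA \o eA) m (ad_mon (iB \o eB) n (iA (eA i) ∘ iB (eB j)))) n'
  = if perm_eq (j :: n) n' then - foldr (fun i => rho (eA i)) (d (eA i)) m else 0.
Proof.
have Cb : commutant P (iA (eA i) ∘ iB (eB j)) := commutantM _ _.
rewrite series_der_monA ?series_der_monB //; last exact: ad_mon_commutant.
rewrite series_der_mul series_der_iA series_der_iB.
rewrite (lin0 (series_act_lin _ _ _ _)) sub0r prA_iB prB_iB.
rewrite /series_act shift_repE.
rewrite [X in X + _](_ : _ = 0) ?add0r; last first.
  by apply/funext => u; exact: lin0 (rep_linl rho _).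
have rho_fold_lin : linear (fun z => foldr (fun i => rho (eA i)) z m).
  by elim: (m) => //= u s IH r x y; rewrite IH rep_linr.
have shift_fold_lin : linear (fun f => foldr (@shift k J N) f n).
  by elim: (n) => //= u s IH r x y; rewrite IH shift_lin.
rewrite (linN shift_fold_lin) (linN rho_fold_lin).
rewrite -(foldr_rcons (@shift k J N)) foldr_shift perm_rcons.
by case: ifP => // _; rewrite (lin0 rho_fold_lin) oppr0.
Qed.

End SeriesDerivation.

Lemma product_swap (k : fieldType) (A B P : lieAlgType k) (iA : A -> P)
    (iB : B -> P) :
  is_metabelian_product iA iB -> is_metabelian_product iB iA.
Proof.
move=> [mP hA hB univ]; split=> // C f g mC hf hg.
have [h [[hh hf' hg'] h_uniq]] := univ C g f mC hg hf.
by exists h; split=> // h' [hh' ? ?]; exact: h_uniq.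
Qed.

Lemma prA_swap (k : fieldType) (A B P : lieAlgType k) (iA : A -> P)
    (iB : B -> P) (mB : metabelian B) (hP : is_metabelian_product iA iB)
    (hP' : is_metabelian_product iB iA) : prA mB hP' =1 prB mB hP.
Proof.
apply: (prod_lift_eq hP mB (prA_hom _ _) (prB_hom _ _)) => c.
  by rewrite prA_iB prB_iA.
by rewrite prA_iA prB_iB.
Qed.

Definition adapted (k : fieldType) (V : lmodType k) (D : set V) (I : Type)
  (e : I -> V) (x : V) : Prop := D x \/ exists i, e i = x.

(** If [rho a] is injective, the coefficients vanish by induction on the degree,
    as [b] acts by zero or by a variable; if not, then [b] is not trivial and
    acts by a variable alone. *)
Lemma series_act_inj (k : fieldType) (A B : lieAlgType k) (N : lmodType k)
    (rho : comm_rep A N) (J : eqType) (eB : J -> B)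
    (bB : basis_mod (commutant B) eB) (S : set N) a b (f : seq J -> N) :
  adapted (commutant B) eB b -> ~ (commutant A a /\ commutant B b) ->
  (~ commutant A a -> forall z, S z -> rho a z = 0 -> z = 0) ->
  (forall n, S (f n)) -> series_act rho bB a b f = 0 -> f = 0.
Proof.
move=> adb nab reg Sf /funeqP f0.
have {f0} f0 n : rho a (f n) + shift_rep N bB b f n = 0 := f0 n.
apply/funext => n; have [Ca|/reg{}reg] := pselect (commutant A a).
  (* The equation in degree [j :: n] isolates the coefficient at [n]. *)
  case: adb nab f0 => [Cb []//|[j <-] _ /(_ (j :: n))].
  by rewrite rep_ker // add0r shift_repE shift_cons.
case: adb nab f0 => [Cb _ f0|[j <-] _ f0].
  by apply: reg => //; have := f0 n; rewrite (rep_ker (shift_rep N bB)) // addr0.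
have [m] := ubnP (size n); elim: m n => // m IH n nm.
apply: reg => //; have := f0 n; rewrite shift_repE /shift.
case: ifP => jn; last by rewrite addr0.
rewrite (IH (rem j n)) ?addr0 // size_rem //.
by case: n jn nm {f0}.
Qed.

Section Regular.
Variables (k : fieldType) (A B P : lieAlgType k) (iA : A -> P) (iB : B -> P).
Hypotheses (mA : metabelian A) (mB : metabelian B).
Hypothesis hP : is_metabelian_product iA iB.
Variables (I J : eqType) (eA : I -> A) (eB : J -> B).
Hypotheses (bA : basis_mod (commutant A) eA) (bB : basis_mod (commutant B) eB).
Variables (leI : rel I) (leJ : rel J).
Hypotheses (loI : linear_order leI) (loJ : linear_order leJ).
Variables x : P.
Local Notation a := (prA mA hP x).
Local Notation b := (prB mB hP x).
Hypotheses (ada : adapted (commutant A) eA a) (adb : adapted (commutant B) eB b).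
Hypothesis nab : ~ (commutant A a /\ commutant B b).

Let mP : metabelian P := prod_meta hP.
Let hA : lie_hom iA. Proof. by case: hP. Qed.
Let hB : lie_hom iB. Proof. by case: hP. Qed.

(** With coefficients in power series in the variables of [A], both factors act
    by variables, the commutants of [A] and [B] act by zero, and [cross m n] has
    a single nonzero coefficient up to rearrangement. *)
Lemma cross_part_eq0 y0 yA yB :
  cross_span iA iB eA eB leI leJ y0 -> factor_ideal iA iB eB leJ yA ->
  factor_ideal iB iA eA leI yB -> x ∘ (y0 + yA + yB) = 0 -> y0 = 0.
Proof.
move=> cy0 tA tB xy0.
pose rho := shift_rep k^o bA.
(* The inner derivation of the series 1 maps a basis vector to its variable. *)
pose d a := rho a (const_series (1 : k^o)).
have d_lin : linear d := rep_linl rho _.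
have d_mul u v : d (u ∘ v) = rho u (d v) - rho v (d u).
  by rewrite /d repC subrr rep_ker //; exact: commutantM.
have dC c : commutant A c -> d c = 0 by move=> Cc; exact: rep_ker.
have Cy : commutant P (y0 + yA + yB).
  by apply: (@normal_form_commutant _ _ _ _ _ _ hP _ _ eA eB leI leJ); exists y0, yA, yB.
pose D := series_der mA mB hP d_lin d_mul bB.
have DL : linear D := series_der_lin mA mB hP d_lin d_mul bB.
have D0 : D (y0 + yA + yB) = 0.
  apply: (series_act_inj (rho := rho) (bB := bB) (S := setT) adb nab) => //.
    move=> nCa z _; case: ada => [//|[i <-]].
    rewrite shift_repE => /funeqP zi; apply/funext => m.
    by have := zi (i :: m); rewrite shift_cons.
  by rewrite -(series_der_lie mA mB hP d_lin d_mul bB) // xy0; exact: lin0 DL.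
have DA : D yA = 0.
  move: yA tA {xy0 Cy D0}; apply: fspan_min; first exact: submod_ker.
  move=> n c _ Cc; apply/funext => n'; rewrite [D _ n']series_der_ideal // dC //.
  by case: ifP.
have DB : D yB = 0 by exact: series_der_other_ideal tB.
have {}D0 : D y0 = 0 by have := D0; rewrite !(linD DL) DA DB !addr0.
have Dcross p m n : cross_index leI leJ p -> sorted leI m -> sorted leJ n ->
    D (cross iA iB eA eB p.1 p.2) n m = - (p == (m, n))%:R.
  case: p => [[|i m'] [|j n']] /and4P[] // _ sm _ sn sm' sn'.
  have rhoE z u : foldr (fun i => rho (eA i)) z u = foldr (@shift k I k^o) z u.
    by elim: u => //= l u ->; exact: shift_repE.
  rewrite [D _ _]series_der_cross rhoE /d [rho _ _]shift_repE.
  rewrite -(foldr_rcons (@shift k I k^o)).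
  have -> : ((i :: m', j :: n') == (m, n)) = perm_eq (i :: m') m && perm_eq (j :: n') n.
    by rewrite (sorted_perm_eq loI) // (sorted_perm_eq loJ).
  rewrite andbC; case: ifP => _; last by rewrite oppr0.
  rewrite fctE foldr_shift perm_rcons; by case: ifP.
case: cy0 D0 => s [c [us sQ _ _ ->]].
rewrite (lin_sum DL) => D0; rewrite big_seq big1 // => q qs.
suff -> : c q = 0 by rewrite scale0r.
have /and4P[_ sm _ sn] := allP sQ q qs.
have := congr1 (fun g : seq J -> seq I -> k^o => g q.2 q.1) D0.
rewrite !fct_sumE /= (bigD1_seq q) //= big1_seq ?addr0 => [|p /andP[pq ps]].
  rewrite (linZ DL) !fctE Dcross ?(allP sQ) // -surjective_pairing eqxx.
  by rewrite scalerN => /eqP; rewrite oppr_eq0 /= [_ *: _]mulr1 => /eqP.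
rewrite (linZ DL) !fctE Dcross ?(allP sQ) // -surjective_pairing (negbTE pq).
by rewrite oppr0 scaler0.
Qed.

(** The coefficients lie in a module containing [commutant A], where [a] acts as
    it does in [A]; the ideal generated by [commutant B] is killed, and the
    coefficients of [yA] can be read off. *)
Lemma ideal_part_eq0 yA yB :
  regular_outside A ->
  factor_ideal iA iB eB leJ yA -> factor_ideal iB iA eA leI yB ->
  x ∘ (yA + yB) = 0 -> yA = 0.
Proof.
move=> regA tA tB xy0; have [N [rho [d [d_lin d_mul d_inj]]]] := magnus_embedding mA.
have CyA : commutant P yA by exact: factor_ideal_commutant tA.
have CyB : commutant P yB by exact: factor_ideal_commutant tB.
pose D := series_der mA mB hP d_lin d_mul bB.
have DL : linear D := series_der_lin mA mB hP d_lin d_mul bB.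
have DB : D yB = 0 by exact: series_der_other_ideal tB.
pose S z := exists2 c, commutant A c & z = d c.
have sS : submod S.
  split=> [|r _ _ [u Cu ->] [v Cv ->]].
    by exists 0; [exact: (commutant_submod A).1|rewrite (lin0 d_lin)].
  by exists (r *: u + v); [exact: (commutant_submod A).2|rewrite d_lin].
have SD n : S (D yA n).
  move: yA tA {xy0 CyA}; apply: (@fspan_min _ _ _ _ _ _ _ (fun y => S (D y n))).
    have DnL : linear (fun y => D y n) by move=> r u v; rewrite DL.
    exact: submod_preim DnL sS.
  move=> s c _ Cc; rewrite [D _ n]series_der_ideal //; case: ifP => _; last exact: sS.1.
  by exists c.
have DA : D yA = 0.
  apply: (series_act_inj (rho := rho) (bB := bB) (S := S) adb nab) => //.
    move=> nCa _ [c Cc ->] ac0; suff -> : c = 0 by exact: lin0.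
    apply: (regA a) => //; apply: d_inj; first exact: commutantM.
    by rewrite d_mul ac0 rep_ker // subrr.
  have DxB : D (x ∘ yB) = 0.
    rewrite [LHS]series_der_lie // -/D DB; exact: lin0 (series_act_lin _ _ _ _).
  rewrite -(series_der_lie mA mB hP d_lin d_mul bB) // -/D.
  have : D (x ∘ (yA + yB)) = 0 by rewrite xy0 (lin0 DL).
  by rewrite lieDr (linD DL) DxB addr0.
case: tA DA => s [c [us sQ _ Cc ->]].
rewrite (lin_sum DL) => D0; rewrite big_seq big1 // => n ns.
suff -> : c n = 0 by rewrite (lin0 hA.1) (lin0 (ad_mon_lin _ _)).
apply: d_inj => //; have := congr1 (fun g : seq J -> N => g n) D0.
rewrite !fct_sumE /= (bigD1_seq n) //= big1_seq ?addr0 => [|p /andP[pn ps]].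
  by rewrite [D _ _]series_der_ideal // perm_refl.
rewrite [D _ _]series_der_ideal // (sorted_perm_eq loJ) ?(negbTE pn) //.
  exact: (allP sQ).
exact: (allP sQ).
Qed.

End Regular.

(** The parts of the normal form of [y] vanish in succession: first the one that
    survives over the abelian quotients, then those from [A] and from [B], the
    roles of the factors being exchanged for the last one. *)
Lemma product_regular (k : fieldType) (A B P : lieAlgType k) (iA : A -> P)
    (iB : B -> P) :
  metabelian A -> metabelian B -> is_metabelian_product iA iB ->
  regular_outside A -> regular_outside B -> regular_outside P.
Proof.
move=> mA mB hP regA regB x y nCx Cy xy0.
have [I [eA [bA ada]]] := basis_mod_ex (commutant_submod A) (prA mA hP x).
have [J [eB [bB adb]]] := basis_mod_ex (commutant_submod B) (prB mB hP x).
have [leI loI] := linear_order_ex I; have [leJ loJ] := linear_order_ex J.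
have [_ hA hB _] := hP.
have nab : ~ (commutant A (prA mA hP x) /\ commutant B (prB mB hP x)).
  move=> [Ca Cb]; apply: nCx.
  have := prod_decomposition mA mB hP bA bB loI loJ x.
  move=> /(normal_form_commutant hP) Cz.
  rewrite -[x](subrK (iA (prA mA hP x) + iB (prB mB hP x))).
  apply: (submodD (commutant_submod P) Cz).
  by apply: (submodD (commutant_submod P)); exact: hom_commutant.
have [y0 [yA [yB [cy0 tA tB yE]]]] := commutant_normal_form mA mB hP bA bB loI loJ Cy.
have y00 : y0 = 0.
  by apply: (cross_part_eq0 bA bB loI loJ ada adb nab cy0 tA tB); rewrite -yE.
rewrite y00 add0r in yE.
have yA0 : yA = 0.
  by apply: (ideal_part_eq0 bB loJ adb nab regA tA tB); rewrite -yE.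
have hP' := product_swap hP.
rewrite yE yA0 add0r.
have swA : prB mA hP' x = prA mA hP x by rewrite -(prA_swap mA hP' hP).
have swB : prA mB hP' x = prB mB hP x by exact: prA_swap.
have adb' : adapted (commutant A) eA (prB mA hP' x) by rewrite swA.
have nab' : ~ (commutant B (prA mB hP' x) /\ commutant A (prB mA hP' x)).
  by rewrite swA swB => -[Cb Ca]; apply: nab.
apply: (ideal_part_eq0 bA loI adb' nab' regB tB tA).
by rewrite -xy0 yE yA0 add0r addr0.
Qed.

(** * Zero divisors and the Fitting radical *)

Section ZeroDivisors.
Variables (k : fieldType) (L : lieAlgType k).
Hypothesis mL : metabelian L.
Implicit Types x y c : L.

(** Brackets act by zero on the commutant, so only multiples of [x] count in its
    ideal; and what [x] kills in the commutant is an ideal. *)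
Lemma ideal_gen_mul_eq0 x c : commutant L c -> x ∘ c = 0 ->
  ideal_mul (ideal_gen [set x]%classic) (ideal_gen [set c]%classic)
  = [set 0]%classic.
Proof.
move=> Cc xc0; apply: ideal_mul_eq0.
pose T z := commutant L z /\ x ∘ z = 0.
have T_ideal : lie_ideal T.
  split=> [|a y z [Cy y0] [Cz z0]|y z [Cy y0]].
  - by split; [exact: (commutant_submod L).1|exact: lie0r].
  - split; first exact: (commutant_submod L).2.
    by rewrite lie_linearr y0 z0 scaler0 addr0.
  - split; first exact: commutantM.
    rewrite lie_leibniz y0 lie0l add0r commutant_abelian //; exact: commutantM.
have T_gen z : ideal_gen [set c]%classic z -> T z.
  by apply: ideal_gen_sub z => // _ ->.
move=> u z xu /T_gen[Cz xz0].
apply: (ideal_gen_sub (I := fun u => u ∘ z = 0) _ _ xu) => [|_ ->] //.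
split=> [|a v w v0 w0|v w v0].
- exact: lie0l.
- by rewrite lie_linearl v0 w0 scaler0 addr0.
- by rewrite commutant_abelian //; exact: commutantM.
Qed.

Lemma zero_divisor_commutant x c : x <> 0 -> commutant L c -> c <> 0 ->
  x ∘ c = 0 -> zero_divisors0 L x.
Proof.
move=> x0 Cc c0 xc0; right; split=> //; exists c; split=> //.
exact: ideal_gen_mul_eq0.
Qed.

Lemma commutant_zero_divisors0 c : commutant L c -> zero_divisors0 L c.
Proof.
move=> Cc; have [->|c0] := pselect (c = 0); first by left.
by apply: (zero_divisor_commutant c0 Cc c0); exact: lie_mulxx.
Qed.

Lemma commutant_fitting c : commutant L c -> fitting L c.
Proof.
move=> Cc; apply: ideal_gen_in; exists (commutant L); split=> //.
split; first exact: commutant_ideal.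
by exists 1%N; apply: ideal_mul_eq0 => u v Cu Cv; exact: commutant_abelian.
Qed.

Definition ad_nilpotent x : Prop :=
  exists n, forall c, commutant L c -> iter n (lie_mul x) c = 0.

Lemma iter_lie_commutant x n c :
  commutant L c -> commutant L (iter n (lie_mul x) c).
Proof. by case: n => //= n _; exact: commutantM. Qed.

(** The operators [lie_mul x] commute on the commutant, so sums of nilpotent ones
    are nilpotent. *)
Lemma ad_nilpotent_ideal : lie_ideal ad_nilpotent.
Proof.
have iter_lin (u : L) n : linear (iter n (lie_mul u)).
  by elim: n => [|n IH] a x y //; rewrite !iterS IH lie_linearr.
have iterC u v n c : commutant L c ->
    iter n (lie_mul u) (v ∘ c) = v ∘ iter n (lie_mul u) c.
  move=> Cc; elim: n => [//|n IH]; rewrite !iterS IH adjoint_comm //.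
  exact: iter_lie_commutant.
split.
- by exists 1%N => c _; exact: lie0l.
- move=> a x y [m xm] [n yn]; exists (m + n)%N.
  (* Multiplying [c] by [x] or by [y] lowers one of the two exponents. *)
  suff H N : forall i j c, (i + j)%N = N -> commutant L c ->
      iter i (lie_mul x) c = 0 -> iter j (lie_mul y) c = 0 ->
      iter N (lie_mul (a *: x + y)) c = 0.
    by move=> c Cc; apply: (H _ m n) => //; [exact: xm|exact: yn].
  elim: N => [[|//] j c _ _ c0 _ //|N IH i j c ijN Cc xi yj].
  rewrite iterSr lie_linearl iter_lin.
  have -> : iter N (lie_mul (a *: x + y)) (x ∘ c) = 0.
    case: i ijN xi => [|i] ijN xi.
      by have -> : c = 0 := xi; rewrite lie0r (lin0 (iter_lin _ N)).
    apply: (IH i j); [by case: ijN|exact: commutantM|by rewrite -iterSr|].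
    by rewrite iterC // yj lie0r.
  have -> : iter N (lie_mul (a *: x + y)) (y ∘ c) = 0.
    case: j ijN yj => [|j] ijN yj.
      by have -> : c = 0 := yj; rewrite lie0r (lin0 (iter_lin _ N)).
    apply: (IH i j); [|exact: commutantM| |by rewrite -iterSr].
      by move: ijN; rewrite addnS => -[].
    by rewrite iterC // xi lie0r.
  by rewrite scaler0 addr0.
- move=> x y _; exists 1%N => c Cc /=.
  by rewrite commutant_abelian //; exact: commutantM.
Qed.

(** Nilpotent ideals consist of such elements, which form an ideal. *)
Lemma fitting_ad_nilpotent x : fitting L x -> ad_nilpotent x.
Proof.
move: x; apply: ideal_gen_sub; first exact: ad_nilpotent_ideal.
move=> x [I [[idI [n In0]] Ix]]; exists n.+1 => c Cc.
suff : ideal_pow I n (iter n.+1 (lie_mul x) c) by rewrite In0.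
(* The first application of [x] brings [c] into [I], each later one gains a
   power of [I]. *)
elim: n {In0} => [|n IH] /=; first by case: idI => _ _; apply.
rewrite lieC; apply: (submodN (ideal_submod (ideal_gen_ideal _))).
exact: ideal_mul_in.
Qed.

(** If [x] is outside the commutant and its ideal annihilates that of [y], then
    [y] is outside as well, and so [x] and [y] cannot both act injectively on the
    element [y ∘ c]; nor can an injective operator be nilpotent. *)
Lemma regular_semidomain : regular_outside L -> (exists2 c, commutant L c & c <> 0) ->
  zero_divisors0 L = commutant L /\ fitting L = commutant L.
Proof.
move=> reg [c Cc c0]; split; apply/seteqP; split.
- move=> x [->|[x0 [y [y0 xy0]]]]; first exact: (commutant_submod L).1.
  apply: contrapT => nCx.
  have xz0 z : ideal_gen [set y]%classic z -> x ∘ z = 0.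
    by move=> yz; apply: (ideal_mul0P xy0) => //; exact: ideal_gen_in.
  have [Cy|nCy] := pselect (commutant L y).
    apply: y0; apply: (reg x) => //; apply: xz0; exact: ideal_gen_in.
  apply: c0; apply: (reg y) => //; apply: (reg x) => //; first exact: commutantM.
  apply: xz0; case: (ideal_gen_ideal [set y]%classic) => _ _; apply.
  exact: ideal_gen_in.
- exact: commutant_zero_divisors0.
- move=> x /fitting_ad_nilpotent[n xn]; apply: contrapT => nCx; apply: c0.
  elim: n xn => [|n IH] xn; first exact: xn.
  apply: IH => d Cd; apply: (reg x) => //; first exact: iter_lie_commutant.
  exact: xn.
- exact: commutant_fitting.
Qed.

Lemma abelian_regular : abelian_lie L -> regular_outside L.
Proof.
move=> abL x c _ Cc _; move: c Cc; apply: commutant_min => [|u v]; last exact: abL.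
exact/ideal_submod/ideal0.
Qed.

Lemma strict_regular : strict_semidomain L -> regular_outside L.
Proof.
move=> sL x c nCx Cc xc0; apply: contrapT => c0; apply: (nCx).
rewrite -sL; apply: (zero_divisor_commutant _ Cc c0 xc0) => x0.
by apply: nCx; rewrite x0; exact: (commutant_submod L).1.
Qed.

End ZeroDivisors.

Section Witnesses.
Variables (k : fieldType) (L : lieAlgType k).
Hypothesis mL : metabelian L.

(** A metabelian algebra equal to its commutant is abelian, hence zero. *)
Lemma commutant_proper : (exists x : L, x <> 0) -> exists x, ~ commutant L x.
Proof.
move=> [x x0]; apply: contrapT => nC; apply: x0.
have C y : commutant L y by apply: contrapT => nCy; apply: nC; exists y.
have abL : abelian_lie L by move=> u v; exact: commutant_abelian.
move: x (C x); apply: commutant_min => [|u v]; last exact: abL.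
exact/ideal_submod/ideal0.
Qed.

(** Let [y] annihilate a zero divisor [x] outside the commutant. Either [y] or
    some [y ∘ z] is the required element for [x], or else [y] is central and
    outside the commutant, and kills any nonzero bracket. *)
Lemma nonregular_witness : ~ (abelian_lie L \/ strict_semidomain L) ->
  exists x c, [/\ ~ commutant L x, commutant L c, c <> 0 & x ∘ c = 0].
Proof.
move=> /not_orP[nab nst].
have [x nCx [x0|[x0 [y [y0 xy0]]]]] : exists2 x, ~ commutant L x & zero_divisors0 L x.
- apply: contrapT => nx; apply: nst; apply/seteqP; split=> x.
    by move=> dx; apply: contrapT => nCx; apply: nx; exists x.
  exact: commutant_zero_divisors0.
- by case: nCx; rewrite x0; exact: (commutant_submod L).1.
have xz0 z : ideal_gen [set y]%classic z -> x ∘ z = 0.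
  by move=> yz; apply: (ideal_mul0P xy0) => //; exact: ideal_gen_in.
have yy : ideal_gen [set y]%classic y by exact: ideal_gen_in.
have [Cy|nCy] := pselect (commutant L y); first by exists x, y; split=> //; exact: xz0.
have [[z yz0]|central] := pselect (exists z, y ∘ z <> 0).
  exists x, (y ∘ z); split=> //; first exact: commutantM.
  by apply: xz0; case: (ideal_gen_ideal [set y]%classic) => _ _; apply.
have [[u [v uv0]]|] := pselect (exists u v : L, u ∘ v <> 0).
  exists y, (u ∘ v); split=> //; first exact: commutantM.
  by apply: contrapT => yuv; apply: central; exists (u ∘ v).
move=> ab; case: nab => u v; apply: contrapT => uv0; apply: ab.
by exists u, v.
Qed.

End Witnesses.

Lemma functional_ex (k : fieldType) (L : lieAlgType k) (x : L) : ~ commutant L x ->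
  exists f : L -> k^o, [/\ linear f, f x = 1 & forall c, commutant L c -> f c = 0].
Proof.
move=> nCx; have [I [e [eB [//|[i ix]]]]] := basis_mod_ex (commutant_submod L) x.
exists (lext (commutant_submod L) eB (fun j => (j == i)%:R : k^o)); split.
- exact: lext_lin.
- by rewrite -ix lextE eqxx.
- by move=> c; exact: lext_ker.
Qed.

Section ProductWitness.
Variables (k : fieldType) (A B P : lieAlgType k) (iA : A -> P) (iB : B -> P).
Hypotheses (mA : metabelian A) (mB : metabelian B).
Hypothesis hP : is_metabelian_product iA iB.

(** In the two-dimensional algebra with basis s, t and [s ∘ t = t], all iterates
    of s on t are t. The functionals [f] and [g] map [A] to multiples of s and
    [B] to multiples of t. *)
Lemma iter_lie_bracket_neq0 a b n : ~ commutant A a -> ~ commutant B b ->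
  iter n (lie_mul (iA a)) (iA a ∘ iB b) <> 0.
Proof.
move=> /functional_ex[f [fL fa fC]] /functional_ex[g [gL gb gC]].
pose act (u : A) (v : B) (m : k^o) : k^o := f u * m.
have act_lin u v : linear (act u v).
  by move=> r x y; rewrite /act mulrDr scalerAr.
have act_linl r u u' v v' m :
    act (r *: u + u') (r *: v + v') m = r *: act u v m + act u' v' m.
  by rewrite /act fL mulrDl -scalerAl.
have actC u v u' v' m : act u v (act u' v' m) = act u' v' (act u v m).
  by rewrite /act mulrCA.
have act_mul u u' v v' m : act (u ∘ u') (v ∘ v') m = 0.
  by rewrite /act fC ?mul0r //; exact: commutantM.
have [||||D [DL DA DB DM]] := prod_derivation mA mB hP
  (rho := CommAction act_lin act_linl actC act_mul) (dA := fun=> 0) (dB := g).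
- by move=> r u v; rewrite scaler0 addr0.
- exact: gL.
- by move=> u u'; rewrite /= /act !mulr0 subrr.
- move=> v v'; rewrite /= /act (lin0 fL) !mul0r subrr gC //; exact: commutantM.
have DE z : D (iA a ∘ z) = D z.
  by rewrite DM DA prA_iA /= /act fa mul1r mulr0 subr0.
move=> /(congr1 D); rewrite (lin0 DL) => /eqP; apply/negP.
elim: n => [|n IH]; last by rewrite iterS DE.
by rewrite /= DE DB gb oner_neq0.
Qed.

(** The factor [A] is a retract of [P], so a witness against it survives in [P],
    where it acts without nilpotency. *)
Lemma semidomain_factor : (exists b : B, b <> 0) -> semidomain P ->
  abelian_lie A \/ strict_semidomain A.
Proof.
move=> nzB sP; apply: contrapT => /(nonregular_witness mA)[x [c [nCx Cc c0 xc0]]].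
have [_ hA hB _] := hP; have mP := prod_meta hP.
have [b nCb] := commutant_proper mB nzB.
have iA_inj z : iA z = 0 -> z = 0.
  by move=> /(congr1 (prA mA hP)); rewrite prA_iA (lin0 (prA_hom mA hP).1).
have : zero_divisors0 P (iA x).
  apply: (zero_divisor_commutant mP (c := iA c)).
  - by move=> /iA_inj x0; apply: nCx; rewrite x0; exact: (commutant_submod A).1.
  - exact: hom_commutant.
  - by move=> /iA_inj.
  - by rewrite -hA.2 xc0 (lin0 hA.1).
rewrite sP => /(fitting_ad_nilpotent mP)[n xn].
by apply: (iter_lie_bracket_neq0 nCx nCb); apply: xn; exact: commutantM.
Qed.

End ProductWitness.

Theorem theorem4 (k : fieldType) (A B : lieAlgType k)
    (hA : metabelian A) (hB : metabelian B)
    (nzA : exists a : A, a <> 0) (nzB : exists b : B, b <> 0)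
    (P : lieAlgType k) (iA : A -> P) (iB : B -> P)
    (hP : is_metabelian_product iA iB) :
  semidomain P <->
    (abelian_lie A \/ strict_semidomain A) /\
    (abelian_lie B \/ strict_semidomain B).
Proof.
split=> [sP|[HA HB]].
  split; first exact: (semidomain_factor hA hB hP).
  exact: (semidomain_factor hB hA (product_swap hP)).
have regular (L : lieAlgType k) : metabelian L ->
    abelian_lie L \/ strict_semidomain L -> regular_outside L.
  by move=> mL [/abelian_regular|/(strict_regular mL)].
have regP : regular_outside P.
  exact: product_regular hA hB hP (regular _ hA HA) (regular _ hB HB).
have [a nCa] := commutant_proper hA nzA; have [b nCb] := commutant_proper hB nzB.
have [|dP fP] := regular_semidomain (prod_meta hP) regP; last first.
  by rewrite /semidomain dP fP.
exists (iA a ∘ iB b); first exact: commutantM.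
exact: (iter_lie_bracket_neq0 hA hB hP (n := 0) nCa nCb).
Qed.
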